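(* Let $G$ be a non-elementary GBS group with non-trivial center $Z$, and let $\varepsilon$ be the associated integer. If the first Betti number of $G$ is at least $2$, then the ranks of fibers form an arithmetic progression: there is an exact sequence $1\to\mathbb{F}_n\to G\to\mathbb{Z}\to1$ if and only if $n$ is of the form $p\varepsilon+1$ with $p\ge1$ an integer.
   Context: A GBS group (generalized Baumslag-Solitar group) is the fundamental group of a finite graph of groups all of whose vertex and edge groups are infinite cyclic. It is non-elementary if it is not isomorphic to $\mathbb{Z}$, $\mathbb{Z}^2$, or the Klein bottle group. For a non-elementary GBS group $G$ with non-trivial center $Z$, $G/Z$ is virtually free, and $\varepsilon+1$ is the smallest rank of a free subgroup of finite index of $G/Z$. $\mathbb{F}_n$ is the free group of finite rank $n$. A fiber of $G$ is a finitely generated kernel of an epimorphism $G\to\mathbb{Z}$. *)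

(* Defs.v *)
(* MathComp, with the classical axioms of MathComp-Analysis: the quotient of a
   group by a normal subgroup, given as an arbitrary classical set, needs them
   to be a groupType. *)
From HB Require Import structures.
From mathcomp Require Import all_boot all_algebra generic_quotient.
From mathcomp Require Import boolp classical_sets.
Set Implicit Arguments.
Unset Strict Implicit.
Unset Printing Implicit Defensive.

Local Open Scope quotient_scope.
Local Open Scope classical_set_scope.
Local Open Scope group_scope.

Notation "{ 'ghom' G -> H }" := (UMagmaMorphism.type G%type H%type)
  (at level 0, G at level 98, H at level 99,
   format "{ 'ghom'  G  ->  H }") : type_scope.

Section Homomorphisms.
Implicit Types G H K : groupType.

Definition surjective (A B : Type) (f : A -> B) : Prop :=
  forall y, exists x, f x = y.

Definition isomorphic G H : Prop := exists f : {ghom G -> H}, bijective f.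

Definition kernel G H (f : {ghom G -> H}) : set G := [set x | f x = 1].

Definition short_exact K G H (i : {ghom K -> G}) (p : {ghom G -> H}) : Prop :=
  [/\ injective i, range i = kernel p & surjective p].

(* Finitely many left cosets yA cover G. *)
Definition finite_index G (A : set G) : Prop :=
  exists s : seq G, forall x, exists2 y, y \in s & A (y^-1 * x).

Definition expgz G (x : G) (k : int) : G :=
  match k with Posz n => x ^+ n | Negz n => x ^- n.+1 end.

End Homomorphisms.

Record normal_subgroup (G : groupType) := NormalSubgroup {
  nsub_set :> G -> Prop;
  nsub1 : nsub_set 1;
  nsubM : forall x y, nsub_set x -> nsub_set y -> nsub_set (x * y);
  nsubV : forall x, nsub_set x -> nsub_set x^-1;
  nsubJ : forall x y, nsub_set x -> nsub_set (x ^ y)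
}.

Section Quotient.
Variables (G : groupType) (N : normal_subgroup G).
Implicit Types x y z : G.

Definition same_coset : rel G := fun x y => `[< N (x^-1 * y) >].

Lemma same_coset_refl : reflexive same_coset.
Proof. by move=> x; apply/asboolP; rewrite mulVg; apply: nsub1. Qed.

Lemma same_coset_sym : symmetric same_coset.
Proof.
suff h x y : same_coset x y -> same_coset y x by move=> x y; apply/idP/idP; exact: h.
by move=> /asboolP /nsubV Nxy; apply/asboolP; rewrite invgM invgK in Nxy.
Qed.

Lemma same_coset_trans : transitive same_coset.
Proof.
move=> y x z /asboolP Nxy /asboolP Nyz; apply/asboolP.
by have := nsubM Nxy Nyz; rewrite -mulgA mulVKg.
Qed.

Canonical same_coset_equiv :=
  EquivRel same_coset same_coset_refl same_coset_sym same_coset_trans.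

Definition quotient_group := {eq_quot same_coset_equiv}.

HB.instance Definition _ := Choice.on quotient_group.

Definition to_quotient (x : G) : quotient_group :=
  (\pi_{eq_quot same_coset_equiv} x)%qT.

Lemma to_quotientP x y : to_quotient x = to_quotient y <-> N (x^-1 * y).
Proof.
split=> [/eqquotP/asboolP //|Nxy].
by apply/eqquotP; apply/asboolP.
Qed.

Definition quotient_repr (u : quotient_group) : G := repr u.

Lemma quotient_reprK : cancel quotient_repr to_quotient.
Proof. by move=> u; apply: reprK. Qed.

Definition quotient_one : quotient_group := to_quotient 1.
Definition quotient_mul (u v : quotient_group) : quotient_group :=
  to_quotient (quotient_repr u * quotient_repr v).
Definition quotient_inv (u : quotient_group) : quotient_group :=
  to_quotient (quotient_repr u)^-1.

Lemma quotient_mulE x y :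
  quotient_mul (to_quotient x) (to_quotient y) = to_quotient (x * y).
Proof.
apply/to_quotientP.
set a := quotient_repr _; set b := quotient_repr _.
have /to_quotientP Na : to_quotient a = to_quotient x by apply: quotient_reprK.
have /to_quotientP Nb : to_quotient b = to_quotient y by apply: quotient_reprK.
have := nsubM Nb (nsubJ y Na).
by rewrite conjgE invgM -!mulgA mulVKg.
Qed.

Lemma quotient_invE x : quotient_inv (to_quotient x) = to_quotient x^-1.
Proof.
apply/to_quotientP; set a := quotient_repr _.
have /to_quotientP Na : to_quotient x = to_quotient a.
  by rewrite quotient_reprK.
by have := nsubJ x^-1 Na; rewrite conjgE !invgK !mulgA mulgV mul1g.
Qed.

Lemma quotient_mulA : associative quotient_mul.
Proof.
move=> u v w.
rewrite -(quotient_reprK u) -(quotient_reprK v) -(quotient_reprK w).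
by rewrite !quotient_mulE mulgA.
Qed.

Lemma quotient_mul1 : left_id quotient_one quotient_mul.
Proof. by move=> u; rewrite -(quotient_reprK u) quotient_mulE mul1g. Qed.

Lemma quotient_mulr1 : right_id quotient_one quotient_mul.
Proof. by move=> u; rewrite -(quotient_reprK u) quotient_mulE mulg1. Qed.

Lemma quotient_mulV : left_inverse quotient_one quotient_inv quotient_mul.
Proof.
by move=> u; rewrite -(quotient_reprK u) quotient_invE quotient_mulE mulVg.
Qed.

Lemma quotient_mulrV : right_inverse quotient_one quotient_inv quotient_mul.
Proof.
by move=> u; rewrite -(quotient_reprK u) quotient_invE quotient_mulE mulgV.
Qed.

HB.instance Definition _ := isGroup.Build quotient_group
  quotient_mulA quotient_mul1 quotient_mulr1 quotient_mulV quotient_mulrV.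

Lemma to_quotient_monoid_morphism : monoid_morphism to_quotient.
Proof. by split=> // x y; rewrite -quotient_mulE. Qed.

HB.instance Definition _ :=
  isUMagmaMorphism.Build G quotient_group to_quotient
    to_quotient_monoid_morphism.

End Quotient.

Section NormalSubgroups.
Variable G : groupType.

Definition center_set : set G := [set z | forall x, commute z x].

Lemma center1 : center_set 1.
Proof. by move=> x; apply/commute_sym/commute1. Qed.

Lemma centerM x y : center_set x -> center_set y -> center_set (x * y).
Proof.
by move=> Zx Zy z; apply/commute_sym/commuteM; apply/commute_sym.
Qed.

Lemma centerV x : center_set x -> center_set x^-1.
Proof. by move=> Zx z; apply/commute_sym/commuteV/commute_sym. Qed.

Lemma centerJ x y : center_set x -> center_set (x ^ y).
Proof. by move=> Zx; rewrite conjgE (Zx y) mulKg. Qed.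

Definition center : normal_subgroup G :=
  NormalSubgroup center1 centerM centerV centerJ.

(* The intersection of all normal subgroups containing R. *)
Definition normal_closure_set (R : set G) : set G :=
  [set x | forall N : normal_subgroup G, R `<=` N -> N x].

Variable R : set G.
Lemma normal_closure1 : normal_closure_set R 1.
Proof. by move=> N _; apply: nsub1. Qed.

Lemma normal_closureM x y : normal_closure_set R x ->
  normal_closure_set R y -> normal_closure_set R (x * y).
Proof. by move=> hx hy N RN; apply: nsubM; [apply: hx | apply: hy]. Qed.

Lemma normal_closureV x : normal_closure_set R x -> normal_closure_set R x^-1.
Proof. by move=> hx N RN; apply/nsubV/hx. Qed.

Lemma normal_closureJ x y :
  normal_closure_set R x -> normal_closure_set R (x ^ y).
Proof. by move=> hx N RN; apply/nsubJ/hx. Qed.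

Definition normal_closure : normal_subgroup G :=
  NormalSubgroup normal_closure1 normal_closureM
    normal_closureV normal_closureJ.

End NormalSubgroups.

(* The conjugate of a commutator is a commutator, so the normal closure of the
   set of commutators is the subgroup they generate. *)
Definition derived_subgroup (G : groupType) : normal_subgroup G :=
  normal_closure [set z : G | exists x y : G, z = [~ x, y]].

Definition abelianization (G : groupType) : groupType :=
  quotient_group (derived_subgroup G).

(* Z-linear independence in an abelian group written multiplicatively. *)
Definition independent (A : groupType) (m : nat) (x : 'I_m -> A) : Prop :=
  forall c : 'I_m -> int,
    \prod_(i < m) expgz (x i) (c i) = 1 -> forall i, c i = 0%R.

(* b is the rank of H_1(G, Z), the abelianization of G. *)
Definition first_betti_number (G : groupType) (b : nat) : Prop :=
  (exists x : 'I_b -> abelianization G, independent x) /\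
  (forall m (x : 'I_m -> abelianization G), independent x -> m <= b).

(* The elements of the free group on X are the reduced words in the letters
   (x, false), standing for x, and (x, true), standing for x^-1. *)
Section FreeGroup.
Variable X : choiceType.
Implicit Types (a : X * bool) (u v w : seq (X * bool)).

Definition letter_inv a : X * bool := (a.1, ~~ a.2).

Definition reduced w := sorted (fun a b => b != letter_inv a) w.

Record free_group := FreeGroup { word_of :> seq (X * bool); _ : reduced word_of }.

HB.instance Definition _ := [isSub for word_of].
HB.instance Definition _ := [Choice of free_group by <:].

Definition cons_reduce a w :=
  if w is b :: w' then (if b == letter_inv a then w' else a :: w) else [:: a].

Definition cat_reduce u w := foldr cons_reduce w u.

Definition word_inv u := rev (map letter_inv u).

Lemma letter_invK : involutive letter_inv.
Proof. by case=> x b; rewrite /letter_inv /= negbK. Qed.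

Lemma word_invK : involutive word_inv.
Proof.
move=> u; rewrite /word_inv map_rev revK -map_comp map_id_in //.
by move=> a _ /=; rewrite letter_invK.
Qed.

Lemma reduced_tl a w : reduced (a :: w) -> reduced w.
Proof. by case: w => //= b w /andP[]. Qed.

Lemma cons_reduced a w : reduced w -> reduced (cons_reduce a w).
Proof.
case: w => //= b w; case: ifPn => [_|ne]; first exact: reduced_tl.
by move=> h; rewrite /reduced /= ne.
Qed.

Lemma cat_reduced u w : reduced w -> reduced (cat_reduce u w).
Proof. by move=> hw; elim: u => //= a u; apply: cons_reduced. Qed.

Lemma cons_reduceK a w : reduced w -> cons_reduce (letter_inv a) (cons_reduce a w) = w.
Proof.
case: w => [|b w] /=; first by rewrite letter_invK eqxx.
have [-> |ne] := eqVneq b (letter_inv a); last by rewrite /= letter_invK eqxx.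
by case: w => //= c w /andP[/negPf -> _].
Qed.

Lemma cons_reduceVK a w : reduced w -> cons_reduce a (cons_reduce (letter_inv a) w) = w.
Proof. by move=> h; rewrite -{1}(letter_invK a) cons_reduceK. Qed.

Lemma cat_reduce0 u : reduced u -> cat_reduce u [::] = u.
Proof.
elim: u => //= a u IH h; rewrite IH; last exact: reduced_tl h.
by case: u h {IH} => //= b u /andP[/negPf -> _].
Qed.

Lemma cat_cons_reduce a u w : reduced w ->
  cat_reduce (cons_reduce a u) w = cons_reduce a (cat_reduce u w).
Proof.
move=> hw; case: u => //= b u; case: eqVneq => [->|//].
by rewrite cons_reduceVK //; apply: cat_reduced.
Qed.

Lemma cat_reduceA u v w : reduced w ->
  cat_reduce u (cat_reduce v w) = cat_reduce (cat_reduce u v) w.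
Proof. by move=> hw; elim: u => //= a u ->; rewrite cat_cons_reduce. Qed.

Lemma cat_word_inv u w : reduced w -> cat_reduce (word_inv u) (cat_reduce u w) = w.
Proof.
elim: u w => //= a u IH w hw; rewrite /word_inv /= rev_cons -cats1.
rewrite /cat_reduce foldr_cat /= cons_reduceK; first exact: IH.
exact: cat_reduced.
Qed.

Lemma word_inv_reduced u : reduced u -> reduced (word_inv u).
Proof.
rewrite /word_inv /reduced rev_sorted sorted_map.
apply: sub_sorted => a b /=; rewrite (inj_eq (can_inj letter_invK)).
by rewrite -(inj_eq (can_inj letter_invK)) letter_invK eq_sym.
Qed.

Lemma word_ofP (u : free_group) : reduced u.
Proof. by case: u. Qed.

Definition free_one : free_group := @FreeGroup [::] isT.
Definition free_mul (u v : free_group) : free_group :=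
  FreeGroup (cat_reduced u (word_ofP v)).
Definition free_inv (u : free_group) : free_group :=
  FreeGroup (word_inv_reduced (word_ofP u)).

Lemma free_mulA : associative free_mul.
Proof. by move=> u v w; apply: val_inj; apply: cat_reduceA; apply: word_ofP. Qed.

Lemma free_mul1 : left_id free_one free_mul.
Proof. by move=> u; apply: val_inj. Qed.

Lemma free_mulr1 : right_id free_one free_mul.
Proof. by move=> u; apply/val_inj/cat_reduce0/word_ofP. Qed.

Lemma free_mulV : left_inverse free_one free_inv free_mul.
Proof.
move=> u; apply: val_inj => /=.
by rewrite -{2}(cat_reduce0 (word_ofP u)) cat_word_inv.
Qed.

Lemma free_mulrV : right_inverse free_one free_inv free_mul.
Proof.
move=> u; rewrite -{1}[u](_ : free_inv (free_inv u) = u) ?free_mulV //.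
by apply/val_inj/word_invK.
Qed.

HB.instance Definition _ := isGroup.Build free_group
  free_mulA free_mul1 free_mulr1 free_mulV free_mulrV.

Definition free_gen (x : X) : free_group := @FreeGroup [:: (x, false)] isT.

End FreeGroup.

Definition presented_group (X : choiceType) (R : set (free_group X)) : groupType :=
  quotient_group (normal_closure R).

Definition free_group_of_rank (n : nat) : groupType := free_group 'I_n.

Definition infinite_cyclic_group : groupType := Algebra.to_multiplicative int.

Definition klein_bottle_group : groupType :=
  presented_group
    (let a := free_gen (@Ordinal 2 0 isT) in
     let t := free_gen (@Ordinal 2 1 isT) in
     [set t * a * t^-1 * a]).

(* The underlying graph has one element of [edge] per unoriented edge, with an
   arbitrary orientation; loops and multiple edges are allowed. *)
Record graph_of_groups := GraphOfGroups {
  vertex : finType;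
  edge : finType;
  source : edge -> vertex;
  target : edge -> vertex;
  vertex_group : vertex -> groupType;
  edge_group : edge -> groupType;
  source_map : forall e, {ghom edge_group e -> vertex_group (source e)};
  target_map : forall e, {ghom edge_group e -> vertex_group (target e)};
  source_map_inj : forall e, injective (source_map e);
  target_map_inj : forall e, injective (target_map e)
}.

Section FundamentalGroup.
Variable Y : graph_of_groups.

Definition adjacent (T : {set edge Y}) : rel (vertex Y) := fun v w =>
  [exists e in T, ((source e == v) && (target e == w))
               || ((source e == w) && (target e == v))].

Definition connecting (T : {set edge Y}) : Prop :=
  forall v w, connect (adjacent T) v w.

Definition connected_graph : Prop :=
  (0 < #|vertex Y|)%N /\ connecting [set: edge Y]%SET.

(* A connected graph is a tree if and only if it has one edge less than
   vertices. *)
Definition maximal_tree (T : {set edge Y}) : Prop :=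
  connecting T /\ #|T|.+1 = #|vertex Y|.

Definition pi1_generator : choiceType :=
  ({v : vertex Y & vertex_group v} + edge Y)%type.

Definition vertex_letter (v : vertex Y) (g : vertex_group v) :
    free_group pi1_generator :=
  free_gen (inl (existT _ v g) : pi1_generator).

Definition stable_letter (e : edge Y) : free_group pi1_generator :=
  free_gen (inr e : pi1_generator).

Inductive pi1_relator (T : {set edge Y}) : set (free_group pi1_generator) :=
| VertexRelator (v : vertex Y) (g h : vertex_group v) :
    pi1_relator T
      (vertex_letter g * vertex_letter h * (vertex_letter (g * h))^-1)
| EdgeRelator (e : edge Y) (c : edge_group e) :
    pi1_relator T
      (stable_letter e * vertex_letter (target_map e c) * (stable_letter e)^-1
         * (vertex_letter (source_map e c))^-1)
| TreeRelator (e : edge Y) : e \in T -> pi1_relator T (stable_letter e).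

(* Up to isomorphism this does not depend on the maximal tree T. *)
Definition fundamental_group (T : {set edge Y}) : groupType :=
  presented_group (pi1_relator T).

End FundamentalGroup.

Definition GBS_group (G : groupType) : Prop :=
  exists (Y : graph_of_groups) (T : {set edge Y}),
    [/\ connected_graph Y, maximal_tree T,
        forall v : vertex Y, isomorphic (vertex_group v) infinite_cyclic_group,
        forall e : edge Y, isomorphic (edge_group e) infinite_cyclic_group
      & isomorphic G (fundamental_group T)].

Definition non_elementary (G : groupType) : Prop :=
  [/\ ~ isomorphic G infinite_cyclic_group,
      ~ isomorphic G (infinite_cyclic_group * infinite_cyclic_group)%type
    & ~ isomorphic G klein_bottle_group].

Definition nontrivial_center (G : groupType) : Prop :=
  exists2 z : G, center G z & z <> 1.

(* A free subgroup of rank r is the range of an injective homomorphism. *)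
Definition has_free_finite_index_subgroup (Q : groupType) (r : nat) : Prop :=
  exists f : {ghom free_group_of_rank r -> Q},
    injective f /\ finite_index (range f).

(* eps + 1 is the smallest rank of a finite-index free subgroup of G / Z(G). *)
Definition associated_integer (G : groupType) (eps : nat) : Prop :=
  has_free_finite_index_subgroup (quotient_group (center G)) eps.+1 /\
  forall r, has_free_finite_index_subgroup (quotient_group (center G)) r ->
    eps.+1 <= r.

(* Main.v *)
(* A GBS group G is generated by elements a_v (vertices) and t_e (edges) subject to
   t_e a_w^mu t_e^-1 = a_v^lam, with t_e = 1 on a maximal tree.

   Weights d_v with lam d_v = mu d_w along the tree turn a_v |-> (x |-> x + d_v) into an
   affine representation of G over Q, with t_e acting by a homothety.  Since G/Z(G) is virtually free and <a_v> is
   commensurated by G, some power of a_v is central unless G/Z(G) is virtually cyclic, and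
   then the relation lam d_v = mu d_w holds for every edge; the virtually cyclic case is
   excluded because b >= 2.  So a_v |-> d_v, t_e |-> 0 is a homomorphism G -> Z, which we
   normalise to an epimorphism phi.  If z generates Z(G) and N = phi(z), then
   a_v^N = z^{d_v}, and N divides psi(z) for every psi : G -> Z.

   Let G act transitively on Omega so that z acts freely with I orbits.  Then so does every
   a_v, with n_v = I |d_v| / N orbits, and the stabilizer of a point is the fundamental
   group of the finite graph whose vertices are the a_v-orbits and whose edges are the
   a_v^lam-orbits: it is free of rank 1 + (I / N) chi, where
   chi = sum_e |lam_e d_v| - sum_v |d_v|.  This applies to Omega = Z with G acting through
   psi : G -> Z, and to Omega = G / S with S a lift to G of a free subgroup of finite index
   in G/Z(G); comparing the two gives chi = eps, so that fibers have rank
   1 + (|psi(z)| / N) eps.  When b >= 2 there is an edge outside the tree, and sending its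
   stable letter to 1 and a_v to p d_v realises |psi(z)| / N = p. *)
Require Import Defs.
From HB Require Import structures.
From mathcomp Require Import all_boot all_order all_algebra zify ring.
From mathcomp Require Import boolp classical_sets.
Set Implicit Arguments.
Unset Strict Implicit.
Unset Printing Implicit Defensive.

Import Order.TTheory GRing.Theory Num.Theory.

Local Open Scope group_scope.

(** * Groups, homomorphisms, integer powers *)

Section IntegerPowers.
Variable G : groupType.
Implicit Types (x y : G) (k l : int).

Lemma expgz1 x : expgz x 1%R = x. Proof. by []. Qed.

Lemma expgzS x k : expgz x (k + 1)%R = expgz x k * x.
Proof.
case: k => [n|[|n]].
    have -> : (n%:Z + 1 = n.+1%:Z)%R by lia.
    by rewrite /= expgSr.
  by rewrite mulVg.
have -> : (Negz n.+1 + 1 = Negz n)%R by lia.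
by rewrite /= [in RHS]expgS invgM mulgVK.
Qed.

Lemma expgzD x k l : expgz x (k + l)%R = expgz x k * expgz x l.
Proof.
elim/int_ind: l => [|n IH|n IH]; first by rewrite addr0 mulg1.
  have -> : (k + n.+1%:Z = k + n%:Z + 1)%R by lia.
  have -> : (n.+1%:Z = n%:Z + 1)%R by lia.
  by rewrite !expgzS IH mulgA.
apply: (mulIg x); rewrite -expgzS.
have -> : (k - n.+1%:Z + 1 = k - n%:Z)%R by lia.
by rewrite IH -mulgA -expgzS; congr (_ * expgz x _); lia.
Qed.

Lemma expgzN x k : expgz x (- k)%R = (expgz x k)^-1.
Proof. by apply: (mulIg (expgz x k)); rewrite -expgzD addNr mulVg. Qed.

Lemma expgzM x k l : expgz x (k * l)%R = expgz (expgz x k) l.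
Proof.
elim/int_ind: l => [|n IH|n IH]; first by rewrite mulr0.
  have -> : (k * n.+1%:Z = k * n%:Z + k)%R by lia.
  have -> : (n.+1%:Z = n%:Z + 1)%R by lia.
  by rewrite expgzS expgzD IH.
have -> : (k * (- n.+1%:Z) = k * (- n%:Z) - k)%R by lia.
have -> : (- n.+1%:Z = - n%:Z - 1)%R by lia.
by rewrite expgzD IH (expgzN x k) expgzD (expgzN _ 1).
Qed.

Lemma expgzC x k l : expgz x k * expgz x l = expgz x l * expgz x k.
Proof. by rewrite -!expgzD addrC. Qed.

Lemma expg1z k : expgz (1 : G) k = 1.
Proof. by case: k => n; rewrite /= expg1n ?invg1. Qed.

Lemma commute_expgz x y k : commute x y -> commute x (expgz y k).
Proof.
by case: k => n cxy; [apply: commuteX | apply/commuteV/commuteX].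
Qed.

Lemma expgzMn x y k : commute x y -> expgz (x * y) k = expgz x k * expgz y k.
Proof.
case: k => n cxy; rewrite /= expgMn // invgM.
by apply: (commuteV (commute_sym _)); apply/commuteV/commuteX2.
Qed.

(* Conjugation relations are kept in the division-free form [g x = y g]. *)
Lemma conj_expgz g x y k : g * x = y * g -> g * expgz x k = expgz y k * g.
Proof.
move=> gx; elim/int_ind: k => [|n IH|n IH]; first by rewrite mulg1 mul1g.
  have -> : (n.+1%:Z = n%:Z + 1)%R by lia.
  by rewrite !expgzS mulgA IH -!mulgA gx.
have -> : (- n.+1%:Z = - n%:Z - 1)%R by lia.
rewrite !expgzD !expgzN !expgz1 mulgA -expgzN IH -!mulgA expgzN; congr (_ * _).
by apply: (mulgI y); rewrite mulVKg mulgA -gx mulgK.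
Qed.

End IntegerPowers.

(** A predicate on bare functions, since most maps below come from choice or from a universal
    property; they are bundled only where a statement asks for it. *)
Definition is_hom (G H : groupType) (f : G -> H) := {morph f : x y / x * y}.

Section Hom.
Variables (G H : groupType) (f : G -> H).
Hypothesis fM : is_hom f.

Lemma is_hom1 : f 1 = 1.
Proof. by apply: (mulgI (f 1)); rewrite -fM !mulg1. Qed.

Lemma is_homV : {morph f : x / x^-1}.
Proof. by move=> x; apply: (mulgI (f x)); rewrite -fM !mulgV is_hom1. Qed.

Lemma is_hom_expgz x k : f (expgz x k) = expgz (f x) k.
Proof.
have fX n : f (x ^+ n) = f x ^+ n.
  by elim: n => [|n IH]; rewrite ?is_hom1 // !expgS fM IH.
by case: k => n; rewrite /= ?is_homV fX.
Qed.

Lemma is_hom_monoid : mathcomp.boot.monoid.monoid_morphism f.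
Proof. by split; [exact: is_hom1 | exact: fM]. Qed.

Definition ghom_of_hom : {ghom G -> H} :=
  HB.pack f (isUMagmaMorphism.Build G H f is_hom_monoid).

Lemma is_hom_inj : (forall x, f x = 1 -> x = 1) -> injective f.
Proof.
move=> f1 x y fxy; apply: (mulIg y^-1); rewrite mulgV; apply: f1.
by rewrite fM is_homV fxy mulgV.
Qed.

End Hom.

Lemma ghom_is_hom (G H : groupType) (f : {ghom G -> H}) : is_hom f.
Proof. exact: gmulfM. Qed.

Definition is_subgroup (G : groupType) (P : G -> Prop) :=
  [/\ P 1, forall x y, P x -> P y -> P (x * y) & forall x, P x -> P x^-1].

Lemma is_subgroup_expgz (G : groupType) (P : G -> Prop) x k :
  is_subgroup P -> P x -> P (expgz x k).
Proof.
case=> P1 PM PV Px; have PX n : P (x ^+ n).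
  by elim: n => [//|n IH]; rewrite expgS; apply: PM.
by case: k => n; [apply: PX | apply/PV/PX].
Qed.

Lemma center_expgz (G : groupType) (z : G) k : center G z -> center G (expgz z k).
Proof.
by apply: is_subgroup_expgz; split; [exact: nsub1|exact: nsubM|exact: nsubV].
Qed.

(** * The additive integers as a multiplicative group *)

Section Infinite_cyclic.
Local Notation Z := infinite_cyclic_group.

Lemma cyclic_mulE (x y : Z) : x * y = ((x : int) + y)%R. Proof. by []. Qed.
Lemma cyclic_invE (x : Z) : x^-1 = (- (x : int))%R. Proof. by []. Qed.
Lemma cyclic_expgzE (x : Z) k : expgz x k = ((x : int) * k)%R.
Proof.
have hX n : (x : Z) ^+ n = ((x : int) * n%:Z)%R.
  elim: n => [|n IH]; first by rewrite mulr0.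
  by rewrite expgS cyclic_mulE IH; lia.
by case: k => n; rewrite /= ?cyclic_invE hX; lia.
Qed.

End Infinite_cyclic.

(** * Free groups *)

Section FreeLift.
Variables (X : choiceType) (G : groupType) (h : X -> G).

Definition letter_val (a : X * bool) : G := if a.2 then (h a.1)^-1 else h a.1.
Definition word_val (w : seq (X * bool)) : G := \prod_(a <- w) letter_val a.
Definition free_lift (u : free_group X) : G := word_val u.

Lemma letter_val_inv a : letter_val (letter_inv a) = (letter_val a)^-1.
Proof. by case: a => x []; rewrite /letter_val /= ?invgK. Qed.

Lemma word_val_cons a w : word_val (a :: w) = letter_val a * word_val w.
Proof. exact: big_cons. Qed.

Lemma word_val_cons_reduce a w :
  word_val (cons_reduce a w) = letter_val a * word_val w.
Proof.
case: w => [|b w] /=; first exact: word_val_cons.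
by case: eqP => [->|_]; rewrite !word_val_cons ?letter_val_inv ?mulVKg.
Qed.

Lemma free_lift_hom : is_hom free_lift.
Proof.
move=> u v; rewrite /free_lift /=; elim: (word_of u) => [|a w IH] /=.
  by rewrite {2}/word_val big_nil mul1g.
by rewrite word_val_cons_reduce IH word_val_cons mulgA.
Qed.

Lemma free_lift_gen x : free_lift (free_gen x) = h x.
Proof. by rewrite /free_lift /word_val /= big_cons big_nil mulg1. Qed.

End FreeLift.

Lemma letter_val_gen (X : choiceType) (a : X * bool) :
  letter_val (@free_gen X) a = @FreeGroup X [:: a] isT.
Proof. by case: a => x [] /=; apply: val_inj. Qed.

Lemma free_group_ind (X : choiceType) (P : free_group X -> Prop) :
  is_subgroup P -> (forall x, P (free_gen x)) -> forall u, P u.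
Proof.
case=> P1 PM PV Pgen [w rw]; elim: w rw => [|a w IH] rw.
  by rewrite (_ : FreeGroup rw = 1) //; apply: val_inj.
have rw' := reduced_tl rw.
have -> : FreeGroup rw = letter_val (@free_gen X) a * FreeGroup rw'.
  rewrite letter_val_gen; apply: val_inj => /=.
  by case: (w) rw => //= b w' /andP[/negPf ->].
by apply: PM => //; rewrite /letter_val; case: a.2; [apply: PV|].
Qed.

Lemma free_hom_ext (X : choiceType) (G : groupType) (f g : free_group X -> G) :
  is_hom f -> is_hom g -> (forall x, f (free_gen x) = g (free_gen x)) -> f =1 g.
Proof.
move=> fM gM fg; apply: free_group_ind => //; split.
- by rewrite !is_hom1.
- by move=> x y fx fy; rewrite fM gM fx fy.
- by move=> x fx; rewrite !is_homV // fx.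
Qed.

Section FreeGroups.

(** Homomorphisms to the group of order 2 are determined by their values on generators: there are
    2^n of them on F_n and 2^m on F_m, and precomposition with a surjection is injective on them. *)
Lemma free_rank_le m n (f : free_group_of_rank m -> free_group_of_rank n) :
  is_hom f -> surjective f -> (n <= m)%N.
Proof.
move=> fM f_surj; pose Z2 : groupType := Algebra.to_multiplicative 'F_2.
pose res (u : {ffun 'I_n -> 'F_2}) : {ffun 'I_m -> 'F_2} :=
  [ffun i => free_lift (u : 'I_n -> Z2) (f (free_gen i))].
have res_inj : injective res.
  move=> u v ruv; apply/ffunP => j; have [x fx] := f_surj (free_gen j).
  have lift_hom (w : {ffun 'I_n -> 'F_2}) :
      is_hom (fun x => free_lift (w : 'I_n -> Z2) (f x)).
    by move=> y z; rewrite fM free_lift_hom.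
  have e : (fun x => free_lift (u : 'I_n -> Z2) (f x)) =1
           (fun x => free_lift (v : 'I_n -> Z2) (f x)).
    apply: free_hom_ext => // i.
    by move/ffunP/(_ i): ruv; rewrite !ffunE.
  by have := e x; rewrite /= fx !free_lift_gen.
have := leq_card res res_inj; rewrite !card_ffun !card_ord.
by rewrite leq_exp2l.
Qed.

Variable X : choiceType.
Implicit Types (u v f g : free_group X) (a b : X * bool).

Definition next : rel (X * bool) := fun a b => b != letter_inv a.
Arguments next : simpl never.
Lemma reducedE (w : seq (X * bool)) : reduced w = sorted next w.
Proof. by []. Qed.
Definition free_letter a : free_group X := @FreeGroup X [:: a] isT.
(** Reduced also when read cyclically, so that positive powers are plain concatenations. *)
Definition cyc_reduced u := (word_of u != [::]) && cycle next (word_of u).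

Lemma word_mul_cat u v : reduced (word_of u ++ word_of v) ->
  word_of (u * v) = word_of u ++ word_of v.
Proof.
move=> /= ruv; rewrite -[RHS](cat_reduce0 ruv).
rewrite /cat_reduce foldr_cat; congr foldr.
by rewrite -[LHS](cat_reduce0 (word_ofP v)).
Qed.

Lemma free_letterV a : (free_letter a)^-1 = free_letter (letter_inv a).
Proof. exact: val_inj. Qed.

Lemma nextV a b : next (letter_inv a) (letter_inv b) = next b a.
Proof.
by rewrite /next letter_invK eq_sym.
Qed.

Lemma cyc_reducedV u : cyc_reduced u -> cyc_reduced u^-1.
Proof.
case/andP=> u0 cu; apply/andP; split.
  by rewrite /= /word_inv -size_eq0 size_rev size_map size_eq0.
rewrite /= /word_inv rev_cycle cycle_map.
by apply: sub_cycle cu => a b /=; rewrite nextV.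
Qed.

(** Nothing cancels between consecutive copies of [c]; the last letter is carried through the
    induction because the next junction depends on it. *)
Lemma cyc_reducedX c a p k : word_of c = a :: p -> cyc_reduced c ->
  cyc_reduced (c ^+ k.+1) /\
  exists2 q, word_of (c ^+ k.+1) = a :: q & last a q = last a p.
Proof.
move=> ec cc; have [_] := andP cc; rewrite ec /= rcons_path => /andP[pp lst].
elim: k => [|k [/andP[_ cX] [q eq lq]]]; first by split=> //; exists p.
have pq : path next a q by move: cX; rewrite eq /= rcons_path => /andP[].
have ew : word_of (c ^+ k.+2) = a :: p ++ a :: q.
  by rewrite expgS word_mul_cat ec eq // reducedE /= cat_path pp /= lst.
split; last by exists (p ++ a :: q); rewrite ?last_cat.
by rewrite /cyc_reduced ew /= rcons_path cat_path pp /= pq last_cat /= lq lst.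
Qed.

Lemma cyc_reducedXz c k : k != 0%R -> cyc_reduced c -> cyc_reduced (expgz c k).
Proof.
case ec: (word_of c) => [|a p]; first by rewrite /cyc_reduced ec.
case: k => [[//|k]|k] _ cc; last apply: cyc_reducedV.
  by case: (cyc_reducedX k ec cc).
by case: (cyc_reducedX k ec cc).
Qed.

(** Induction on the length: if the last letter is the inverse of the first one, conjugation by that
    letter removes both. *)
Lemma cyc_reduced_conj f : f != 1 ->
  exists g c, cyc_reduced c /\ f * g = g * c.
Proof.
move: {2}(size _) (leqnn (size (word_of f))) => n.
elim: n f => [|n IH] f.
  by rewrite leqn0 size_eq0 => /eqP f0 /eqP[]; apply: val_inj.
case ef: (word_of f) => [|a w]; first by move=> _ /eqP[]; apply: val_inj.
move=> sz f1; have rf := word_ofP f; rewrite ef in rf.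
case cf: (cyc_reduced f); first by exists 1, f; rewrite mulg1 mul1g.
move: cf; rewrite /cyc_reduced ef /= rcons_path.
have -> /= : path next a w by exact: rf.
move/negbFE/eqP => ea.
case/lastP: w ef sz rf ea => [|w b] ef sz rf ea.
  by case: a {rf sz ef} ea => x [].
rewrite last_rcons in ea; have rw : reduced w.
  by move/reduced_tl: rf; rewrite -cats1 reducedE => /cat_sorted2[].
have ef' : f = free_letter a * FreeGroup rw * (free_letter a)^-1.
  have rfw := rf; move: rfw; rewrite reducedE /= rcons_path => /andP[paw nb].
  have e1 : word_of (free_letter a * FreeGroup rw) = a :: w by exact: word_mul_cat.
  have eb : letter_inv a = b by rewrite ea letter_invK.
  apply: val_inj; rewrite free_letterV eb /=.
  have := @word_mul_cat (free_letter a * FreeGroup rw) (free_letter b).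
  by rewrite e1 /= ef -cats1 /= => -> //; rewrite cats1.
have [] := IH (FreeGroup rw).
- by move: sz; rewrite /= size_rcons; lia.
- apply: contraNneq f1 => w1; rewrite ef' w1 mulg1 mulgV //.
move=> g [c [cc e]]; exists (free_letter a * g), c; split=> //.
by rewrite ef' -!mulgA mulKg e.
Qed.

(** The cyclic group generated by [f] is commensurable with each of its conjugates, in division-free
    form. *)
Definition commensurated (G : groupType) (f : G) := forall g : G,
  exists p q : int, [/\ p != 0%R, q != 0%R & g * expgz f q = expgz f p * g].

(* For c cyclically reduced and a letter x cancelling on neither side, x c^q x^-1
   is a reduced word that is not cyclically reduced, so it is no power of c. *)
Lemma commensurated_free (x y : X) f : x != y -> commensurated f -> f = 1.
Proof.
move=> xy fC; apply/eqP/negP => /negP /cyc_reduced_conj[g [c [cc efg]]].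
have cC : commensurated c.
  move=> h; have [p [q [p0 q0 e]]] := fC (g * h * g^-1).
  exists p, q; split=> //; apply: (mulgI g); apply: (mulIg g^-1).
  have cg k : g * expgz c k = expgz f k * g by apply: conj_expgz.
  have cg' k : expgz c k * g^-1 = g^-1 * expgz f k.
    by apply: (mulgI g); rewrite mulgA cg mulgK mulVKg.
  by rewrite -!mulgA cg' !mulgA e cg !mulgA.
have [a [p ec]] : exists a p, word_of c = a :: p.
  by case/andP: cc; case: (word_of c) => // a p _ _; exists a, p.
(* Only two letters are forbidden, and two generators supply three distinct candidates. *)
have [b] : exists b, (b != letter_inv a) && (b != last a p).
  pose s := [:: (x, false); (x, true); (y, false)].
  have : has [pred b | (b != letter_inv a) && (b != last a p)] s.
    have us : uniq s by rewrite /= !inE !xpair_eqE eqxx /= andbF (negPf xy).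
    apply: contraT => /hasPn ns.
    suff /(uniq_leq_size us) : {subset s <= [:: letter_inv a; last a p]} by [].
    move=> b /ns; rewrite /= negb_and !negbK !inE.
    by [].
  by case/hasP => b _ /= ?; exists b.
case/andP=> ba bl.
have [k' [l' [k0 l0 e]]] := cC (free_letter b).
(* Inverting both powers if necessary makes the exponent on the left a positive natural number. *)
have [n [k [k0' e']]] : exists n k, k != 0%R /\
   free_letter b * c ^+ n.+1 = expgz c k * free_letter b.
  case: l' l0 e => [[//|n]|n] _ e; first by exists n, k'.
  exists n, (- k')%R; split; first by rewrite oppr_eq0.
  rewrite expgzN; apply: (mulgI (expgz c k')); rewrite mulgA -e -!mulgA /=.
  by rewrite mulVKg mulVg mulg1.
have [/andP[_ cX] [q eq lq]] := cyc_reducedX n ec cc.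
have ck := cyc_reducedXz k0' cc.
have {}e' : expgz c k = free_letter b * c ^+ n.+1 * free_letter (letter_inv b).
  by rewrite e' -free_letterV mulgK.
have pq : path next a q by move: cX; rewrite eq /= rcons_path => /andP[].
have nba : next b a.
  by rewrite /next -(inj_eq (can_inj (@letter_invK X))) letter_invK eq_sym.
have nlb : next (last a q) (letter_inv b).
  by rewrite /next (inj_eq (can_inj (@letter_invK X))) lq.
have e1 : word_of (free_letter b * c ^+ n.+1) = [:: b, a & q].
  by rewrite word_mul_cat eq ?reducedE /= ?nba.
have e2 : word_of (expgz c k) = [:: b, a & rcons q (letter_inv b)].
  by rewrite e' word_mul_cat e1 ?reducedE /= ?cats1 // nba rcons_path pq.
move: ck; rewrite /cyc_reduced e2 /= !rcons_path last_rcons.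
by rewrite /next letter_invK eqxx !andbF.
Qed.

End FreeGroups.

Lemma free1_gen (u : free_group_of_rank 1) : exists k, u = expgz (free_gen ord0) k.
Proof.
apply: (free_group_ind (P := fun u => exists k, u = expgz (free_gen ord0) k)).
  split; first by exists 0%R.
    by move=> x y [k ->] [l ->]; exists (k + l)%R; rewrite expgzD.
  by move=> x [k ->]; exists (- k)%R; rewrite expgzN.
by move=> x; exists 1%R; rewrite expgz1 (ord1 x).
Qed.

(** Rank 0 is trivial and rank 1 maps to the integers; in rank at least 2 a torsion element is
    commensurated, as one of its nonzero powers is 1. *)
Lemma free_torsion_free n (u : free_group_of_rank n) k :
  k != 0%R -> expgz u k = 1 -> u = 1.
Proof.
move=> k0 uk; case: n u uk => [|[|n]] u uk.
- apply: (free_group_ind (P := fun u => u = 1)) => [|[]//].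
  by split=> // [x y -> ->|x ->]; rewrite ?mulg1 ?invg1.
- have [l ul] := free1_gen u; rewrite {}ul -expgzM in uk *.
  have e := is_hom_expgz (@free_lift_hom _ infinite_cyclic_group
    (fun _ : 'I_1 => 1%R : int)) (free_gen ord0) (l * k)%R.
  rewrite uk free_lift_gen cyclic_expgzE mul1r is_hom1 in e; last exact: free_lift_hom.
  have : (l * k == 0)%R by apply/eqP; rewrite -e.
  by rewrite mulf_eq0 (negPf k0) orbF => /eqP ->.
- apply: (@commensurated_free _ ord0 ord_max) => // g.
  by exists k, k; split; rewrite // uk mulg1 mul1g.
Qed.

(** * Spanning trees of finite graphs *)

Section SpanningTree.
Variables (V E : finType) (s t : E -> V).
Implicit Types (T : {set E}) (v : V).

(** Connectedness as an induction principle from the root [v0], the form in which it is applied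
    throughout. *)
Definition graph_connected T v0 := forall P : V -> Prop, P v0 ->
  (forall e, e \in T -> (P (s e) <-> P (t e))) -> forall v, P v.

(* Every labelling of the edges by bijections f e of X can be trivialised along T. *)
Definition has_gauges T v0 := forall (X : Type) (f f' : E -> X -> X) (x0 : X),
  (forall e, cancel (f' e) (f e)) ->
  exists p : V -> X, p v0 = x0 /\ forall e, e \in T -> p (s e) = f e (p (t e)).

(** The tree grows from [v0] by one edge and one new vertex at a time, and the gauges are extended
    to that vertex in the same induction. *)
Lemma spanning_tree T v0 : graph_connected T v0 -> exists T' : {set E},
  [/\ T' \subset T, (#|T'|.+1 = #|V|)%N, graph_connected T' v0 & has_gauges T' v0].
Proof.
move=> Tconn.
have grow k : (k < #|V|)%N -> exists (U : {set V}) (T' : {set E}),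
    [/\ #|U| = k.+1, v0 \in U, T' \subset T /\ #|T'| = k,
        forall e, e \in T' -> (s e \in U) && (t e \in U) &
        (forall P : V -> Prop, P v0 ->
          (forall e, e \in T' -> (P (s e) <-> P (t e))) ->
          forall v, v \in U -> P v) /\ has_gauges T' v0].
  elim: k => [_|k IH /[dup] kV /ltnW /IH].
    exists [set v0]%SET, finset.set0; split.
    - by rewrite cards1.
    - by rewrite inE.
    - by rewrite finset.sub0set cards0.
    - by move=> e; rewrite finset.in_set0.
    - split=> [P Pv0 _ v|X f f' x0 _]; first by rewrite inE => /eqP ->.
      by exists (fun _ => x0); split=> // e; rewrite finset.in_set0.
  case=> U [T' [cU U0 [T'T cT'] endU [connU gU]]].
  (* Otherwise membership in [U] would propagate from [v0] along [T] to every vertex, against the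
     cardinality of [U]. *)
  have [e eT eU] : exists2 e, e \in T & (s e \in U) != (t e \in U).
    apply: contrapT => noe; move: kV; rewrite -cU ltnNge => /negP; apply.
    rewrite -cardsT; apply/subset_leq_card/fintype.subsetP => v _.
    apply: (Tconn (fun v => v \in U)) => // e eT.
    suff -> : (s e \in U) = (t e \in U) by [].
    by apply/eqP/negP => /negP h; apply: noe; exists e.
  pose w := if s e \in U then t e else s e.
  have wU : w \notin U.
    by move: eU; rewrite /w; case: ifP => [_|/negbT //]; case: (t e \in U).
  have eT' : e \notin T'.
    by apply/negP => /endU; move: eU; case: (s e \in U); case: (t e \in U).
  have endw f : f \in T' -> (s f != w) && (t f != w).
    move=> /endU /andP[sU tU].
    by apply/andP; split; apply: contraNneq wU => <-.
  exists (w |: U)%SET, (e |: T')%SET; split.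
  - by rewrite cardsU1 wU cU.
  - by rewrite !inE U0 orbT.
  - split; last by rewrite cardsU1 eT' cT'.
    by rewrite finset.subUset finset.sub1set eT.
  - move=> f; rewrite !inE => /orP[/eqP ->|/endU /andP[-> ->]]; last by rewrite !orbT.
    by move: eU; rewrite /w; case: (s e \in U); case: (t e \in U) => // _;
      rewrite eqxx ?orbT.
  - split=> [P Pv0 PT v|X f f' x0 fK].
      have PU : forall v, v \in U -> P v.
        by apply: connU => // f fT; apply: PT; rewrite !inE fT orbT.
      rewrite !inE => /orP[/eqP ->|]; last exact: PU.
      have := PT e; rewrite !inE eqxx => /(_ isT).
      move: eU wU; rewrite /w; case: ifP => sU; last first.
        by case tU: (t e \in U) => // _ _ [_]; apply; apply: PU.
      by move=> _ _ [h _]; apply/h/PU.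
    have [p [p0 pT]] := gU X f f' x0 fK.
    (* The value at the new vertex [w] is forced by the new edge, through [f'] or [f] according to
       which end of the edge is [w]. *)
    exists (fun v => if v == w then
      (if s e \in U then f' e (p (s e)) else f e (p (t e))) else p v); split.
      by case: eqP wU U0 => // <- /negP.
    move=> g; rewrite !inE => /orP[/eqP -> {g}|gT]; last first.
      by have /andP[/negPf -> /negPf ->] := endw _ gT; apply: pT.
    move: eU wU; rewrite /w; case: ifP => sU.
      case tU: (t e \in U) => // _ _; rewrite eqxx ifN ?fK //.
      by apply: contraFneq tU => <-.
    case tU: (t e \in U) => // _ _; rewrite eqxx ifN //.
    by apply: contraFneq sU => <-.
have V0 : (0 < #|V|)%N by apply/card_gt0P; exists v0.
have [|U [T' [cU _ [T'T cT'] _ [connU gU]]]] := grow #|V|.-1.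
  by rewrite prednK.
rewrite prednK // in cU.
have UT v : v \in U.
  have /eqP -> : U == [set: V]%SET by rewrite finset.eqEcard finset.subsetT cardsT cU /=.
  by rewrite inE.
exists T'; split=> //; first by rewrite cT' prednK.
by move=> P P0 PT v; apply: connU.
Qed.

(** A spanning tree contained in [T] has as many edges as [T], hence equals it. *)
Lemma tree_gauges T v0 : graph_connected T v0 -> (#|T|.+1 = #|V|)%N ->
  has_gauges T v0.
Proof.
move=> Tconn cT; have [T' [T'T cT' _ gT']] := spanning_tree Tconn.
suff <- : T' = T by [].
by apply/eqP; rewrite finset.eqEcard T'T -ltnS cT cT' /=.
Qed.

End SpanningTree.

(** * Stabilizers in a group acting with free vertex orbits *)

Record left_action (G : groupType) (Omega : Type) := LeftAction {
  lact :> G -> Omega -> Omega;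
  lact1 : forall w, lact 1 w = w;
  lactM : forall g h w, lact (g * h) w = lact g (lact h w)
}.

Section ActionTheory.
Variables (G : groupType) (Omega : Type) (act : left_action G Omega).

Lemma lactK g : cancel (act g) (act g^-1).
Proof. by move=> w; rewrite -lactM mulVg lact1. Qed.
Lemma lactVK g : cancel (act g^-1) (act g).
Proof. by move=> w; rewrite -lactM mulgV lact1. Qed.

End ActionTheory.

(* The wreath product X^Omega x| G; homomorphisms from G into it that lift the
   identity of G are the X-valued cocycles of the action. *)
Definition wreath (G : groupType) (Omega : Type) (act : left_action G Omega)
  (X : groupType) : Type := ((Omega -> X) * G)%type.

HB.instance Definition _ G Omega act X := gen_eqMixin (@wreath G Omega act X).
HB.instance Definition _ G Omega act X := gen_choiceMixin (@wreath G Omega act X).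

Section WreathGroup.
Variables (G : groupType) (Omega : Type) (act : left_action G Omega) (X : groupType).
Local Notation W := (wreath act X).

Definition wreath_one : W := (fun _ => 1, 1).
Definition wreath_mul (u v : W) : W :=
  (fun w => u.1 (act v.2 w) * v.1 w, u.2 * v.2).
Definition wreath_inv (u : W) : W :=
  (fun w => (u.1 (act u.2^-1 w))^-1, u.2^-1).

Lemma wreath_mulA : associative wreath_mul.
Proof.
move=> [f g] [f' g'] [f'' g'']; congr pair => /=; last by rewrite mulgA.
by apply/funext => w; rewrite lactM mulgA.
Qed.
Lemma wreath_mul1 : left_id wreath_one wreath_mul.
Proof.
by case=> f g; congr pair; rewrite /= ?mul1g //; apply/funext => w; rewrite mul1g.
Qed.
Lemma wreath_mulr1 : right_id wreath_one wreath_mul.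
Proof.
case=> f g; congr pair; rewrite /= ?mulg1 //.
by apply/funext => w; rewrite lact1 mulg1.
Qed.
Lemma wreath_mulV : left_inverse wreath_one wreath_inv wreath_mul.
Proof.
case=> f g; congr pair; rewrite /= ?mulVg //.
by apply/funext => w; rewrite lactK mulVg.
Qed.
Lemma wreath_mulrV : right_inverse wreath_one wreath_inv wreath_mul.
Proof.
by case=> f g; congr pair; rewrite /= ?mulgV //; apply/funext => w; rewrite mulgV.
Qed.

HB.instance Definition _ := isGroup.Build W
  wreath_mulA wreath_mul1 wreath_mulr1 wreath_mulV wreath_mulrV.

Definition wreath_base (f : Omega -> X) : W := (f, 1).
Definition wreath_top (g : G) : W := (fun _ => 1, g).

Lemma wreath_mulE (u v : W) :
  u * v = (fun w => u.1 (act v.2 w) * v.1 w, u.2 * v.2) :> W.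
Proof. by []. Qed.

Lemma wreath_top_hom : is_hom wreath_top.
Proof.
by move=> g h; rewrite wreath_mulE; congr pair; apply/funext => w; rewrite mulg1.
Qed.

Lemma wreath_baseV f : (wreath_base f)^-1 = wreath_base (fun w => (f w)^-1).
Proof.
by congr pair; rewrite /= ?invg1 //; apply/funext => w; rewrite lact1.
Qed.

Lemma wreath_baseM f f' :
  wreath_base f * wreath_base f' = wreath_base (fun w => f w * f' w).
Proof.
by rewrite wreath_mulE; congr pair; rewrite /= ?mulg1 //; apply/funext => w; rewrite lact1.
Qed.

Lemma wreath_base_top f g : (forall w, f (act g w) = f w) ->
  wreath_base f * wreath_top g = wreath_top g * wreath_base f.
Proof.
move=> fg; rewrite !wreath_mulE; congr pair => /=; last by rewrite mulg1 mul1g.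
by apply/funext => w; rewrite mul1g mulg1 fg.
Qed.

End WreathGroup.

(* A bijection of Omega with 'I_n * Z carrying A to translation: A is a free action of Z
   with n orbits. *)
Record orbit_data (Omega : Type) (A : int -> Omega -> Omega) (n : nat) := OrbitData {
  orb_rep : 'I_n -> Omega;
  orb_cls : Omega -> 'I_n;
  orb_pos : Omega -> int;
  orb_repK : forall w, A (orb_pos w) (orb_rep (orb_cls w)) = w;
  orb_clsA : forall i k, orb_cls (A k (orb_rep i)) = i;
  orb_posA : forall i k, orb_pos (A k (orb_rep i)) = k
}.

Definition free_orbits (Omega : Type) (A : int -> Omega -> Omega) (n : nat) :=
  inhabited (orbit_data A n).

(** Choice turns pointwise existence into a single family of data. *)
Lemma inhabited_forall (I : Type) (D : I -> Type) :
  (forall i, inhabited (D i)) -> inhabited (forall i, D i).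
Proof.
move=> inh; suff : forall i, {x : D i | True} by move=> d; split=> i; case: (d i).
by move=> i; apply: cid; case: (inh i) => x; exists x.
Qed.

Definition zact (G : groupType) (Omega : Type) (act : left_action G Omega) (g : G) :=
  fun k => act (expgz g k).

Section OrbitData.
Variables (G : groupType) (Omega : Type) (act : left_action G Omega) (g : G).
Variables (n : nat) (D : orbit_data (zact act g) n).

Lemma orb_cls_act k w : orb_cls D (act (expgz g k) w) = orb_cls D w.
Proof.
rewrite -{1}(orb_repK D w) /zact -lactM -expgzD.
exact: (orb_clsA D (orb_cls D w) (k + orb_pos D w)%R).
Qed.

Lemma orb_pos_act k w : orb_pos D (act (expgz g k) w) = (k + orb_pos D w)%R.
Proof.
rewrite -{1}(orb_repK D w) /zact -lactM -expgzD.
exact: (orb_posA D (orb_cls D w) (k + orb_pos D w)%R).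
Qed.

Lemma orb_rep_eq w : orb_rep D (orb_cls D w) = act (expgz g (- orb_pos D w)%R) w.
Proof.
by rewrite -{3}(orb_repK D w) /zact -lactM -expgzD addNr lact1.
Qed.

End OrbitData.

Section Presentation.
Variables (V E : finType) (s t : E -> V) (T : {set E}) (lam mu : E -> int).

Definition gbs_relations (X : groupType) (a : V -> X) (tau : E -> X) :=
  (forall e, tau e * expgz (a (t e)) (mu e) = expgz (a (s e)) (lam e) * tau e) /\
  (forall e, e \in T -> tau e = 1).

(** Generation and the universal property replace an explicit quotient of a free group: the former
    gives inductions over [G], the latter all homomorphisms out of it. *)
Record gbs_presentation (v0 : V) (G : groupType) (a : V -> G) (tau : E -> G) : Prop :=
  GbsPresentation {
    gbs_tree : graph_connected s t T v0;
    gbs_card : (#|T|.+1 = #|V|)%N;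
    gbs_lam : forall e, lam e != 0%R;
    gbs_mu : forall e, mu e != 0%R;
    gbs_rel : gbs_relations a tau;
    gbs_gen : forall P : G -> Prop, is_subgroup P -> (forall v, P (a v)) ->
      (forall e, P (tau e)) -> forall g, P g;
    gbs_univ : forall (X : groupType) (a' : V -> X) (tau' : E -> X),
      gbs_relations a' tau' -> exists f : G -> X,
        [/\ is_hom f, forall v, f (a v) = a' v & forall e, f (tau e) = tau' e]
  }.

Lemma gbs_gauges v0 (G : groupType) (a : V -> G) tau :
  gbs_presentation v0 a tau -> has_gauges s t T v0.
Proof. by case=> Tc cT _ _ _ _ _; apply: tree_gauges. Qed.

End Presentation.

Section FreeStabilizer.
Variables (V E : finType) (s t : E -> V) (T : {set E}) (lam mu : E -> int) (v0 : V).
Variables (G : groupType) (a : V -> G) (tau : E -> G).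
Hypothesis pres : gbs_presentation s t T lam mu v0 a tau.
Variables (Omega : Type) (act : left_action G Omega) (w0 : Omega).
Hypothesis trans : forall w, exists g, act g w0 = w.
Variables (n : V -> nat) (m : E -> nat).
Variable D : forall v, orbit_data (zact act (a v)) (n v).
Variable DE : forall e, orbit_data (zact act (expgz (a (s e)) (lam e))) (m e).

(* The quotient graph of orbits: its vertices are the orbits of the a_v, its
   edges those of the edge groups. *)
Let QV : finType := {v : V & 'I_(n v)}.
Let QE : finType := {e : E & 'I_(m e)}.
Let vcls v w : QV := Tagged (fun v => 'I_(n v)) (orb_cls (D v) w).
Let ecls e w : QE := Tagged (fun e => 'I_(m e)) (orb_cls (DE e) w).
Let vrep (x : QV) : Omega := orb_rep (D (tag x)) (tagged x).
Let erep (y : QE) : Omega := orb_rep (DE (tag y)) (tagged y).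
Let qs (y : QE) : QV := vcls (s (tag y)) (erep y).
Let qt (y : QE) : QV := vcls (t (tag y)) (act (tau (tag y))^-1 (erep y)).

Lemma quotient_vcls_act v k w : vcls v (act (expgz (a v) k) w) = vcls v w.
Proof. by rewrite /vcls orb_cls_act. Qed.

Lemma quotient_ecls_act e k w :
  ecls e (act (expgz (expgz (a (s e)) (lam e)) k) w) = ecls e w.
Proof. by rewrite /ecls orb_cls_act. Qed.

Lemma vcls_vrep x : vcls (tag x) (vrep x) = x.
Proof.
case: x => v i; rewrite /vcls /vrep /=; congr existT.
by have := orb_clsA (D v) i 0%R; rewrite /zact lact1.
Qed.

Lemma ecls_erep y : ecls (tag y) (erep y) = y.
Proof.
case: y => e i; rewrite /ecls /erep /=; congr existT.
by have := orb_clsA (DE e) i 0%R; rewrite /zact lact1.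
Qed.

Lemma tau_conj e k : (tau e)^-1 * expgz (expgz (a (s e)) (lam e)) k =
  expgz (expgz (a (t e)) (mu e)) k * (tau e)^-1.
Proof.
apply: conj_expgz; have [r _] := gbs_rel pres.
by apply: (mulgI (tau e)); rewrite mulVKg mulgA r mulgK.
Qed.

Lemma qs_ecls e w : qs (ecls e w) = vcls (s e) w.
Proof.
by rewrite /qs /erep /= orb_rep_eq -expgzM quotient_vcls_act.
Qed.

Lemma qt_ecls e w : qt (ecls e w) = vcls (t e) (act (tau e)^-1 w).
Proof.
by rewrite /qt /erep /= orb_rep_eq -lactM tau_conj lactM -expgzM quotient_vcls_act.
Qed.

(** A property constant along edges takes the same value at all orbits through one point, by the
    tree [T]; it is then invariant under every generator of [G], and the action is transitive. *)
Lemma quotient_graph_connected : graph_connected qs qt [set: QE]%SET (vcls v0 w0).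
Proof.
move=> P P0 PE.
have PE' e w : P (vcls (s e) w) <-> P (vcls (t e) (act (tau e)^-1 w)).
  by rewrite -qs_ecls -qt_ecls; apply: PE; rewrite finset.in_setT.
have [_ relT] := gbs_rel pres.
have PV v w : P (vcls v0 w) <-> P (vcls v w).
  move: v; apply: (gbs_tree pres) => // e eT.
  have := PE' e w; rewrite relT // invg1 lact1 => h.
  by tauto.
suff Pg : forall g w, P (vcls v0 w) <-> P (vcls v0 (act g w)).
  move=> x; rewrite -(vcls_vrep x); apply/PV.
  by have [g <-] := trans (vrep x); have := Pg g w0; tauto.
apply: (gbs_gen pres).
- split=> [w|g h Pg Ph w|g Pg w]; first by rewrite lact1.
    by rewrite lactM; have := Pg (act h w); have := Ph w; tauto.
  by have := Pg (act g^-1 w); rewrite lactVK; tauto.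
- move=> v w; have := PV v w; have := PV v (act (a v) w).
  by rewrite -{2}(expgz1 (a v)) quotient_vcls_act; tauto.
- move=> e w; have := PV (s e) (act (tau e) w); have := PE' e (act (tau e) w).
  by rewrite lactK; have := PV (t e) w; tauto.
Qed.

(* The stabilizer is free on the edges of the quotient graph outside a spanning tree: psi
   reads off the generator of an edge from a transversal hh, and its inverse is the cocycle
   c given by a homomorphism from G to the wreath product, which exists by the
   presentation of G. *)
Lemma stabilizer_free_data : exists r (i : free_group_of_rank r -> G),
  [/\ (r + #|QV| = #|QE| + 1)%N, is_hom i, injective i &
      forall g, (exists u, i u = g) <-> act g w0 = w0].
Proof.
have [T' [_ cT' T'conn T'gauge]] := spanning_tree quotient_graph_connected.
pose B := (~: T')%SET; pose r := #|B|.
pose X := free_group_of_rank r.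
pose bgen (i : 'I_r) : X := free_gen i.
(* Edges outside the tree carry the free generators, tree edges carry 1. *)
pose x (y : QE) : X := if [pick i : 'I_r | enum_val i == y] is Some i then bgen i else 1.
have xT y : y \in T' -> x y = 1.
  move=> yT; rewrite /x; case: pickP => // i /eqP ei.
  by have := enum_valP i; rewrite ei finset.in_setC yT.
have x_enum (i : 'I_r) : x (enum_val i) = bgen i.
  rewrite /x; case: pickP => [j /eqP /enum_val_inj -> //|/(_ i)].
  by rewrite eqxx.
have [_ relT] := gbs_rel pres.
pose k0 := orb_pos (D v0) w0.
(* Transversal: hh v w maps w0 to w, equivariantly along the orbits of a_v and
   along the edges of the spanning tree. *)
pose ell (y : QE) : G :=
  expgz (a (s (tag y))) (- orb_pos (D (s (tag y))) (erep y))%R * tau (tag y) *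
  expgz (a (t (tag y))) (orb_pos (D (t (tag y))) (act (tau (tag y))^-1 (erep y))).
have [h [h0 hT]] := T'gauge G (fun y g => ell y * g) (fun y g => (ell y)^-1 * g)
  (expgz (a v0) (- k0)%R) (fun y => mulVKg (ell y)).
pose hh v w := expgz (a v) (orb_pos (D v) w) * h (vcls v w).
have hhE v w : hh v w = expgz (a v) (orb_pos (D v) w) * h (vcls v w) by [].
clearbody hh.
have hh_act v k w : hh v (act (expgz (a v) k) w) = expgz (a v) k * hh v w.
  by rewrite !hhE quotient_vcls_act orb_pos_act expgzD mulgA.
have hh0 : hh v0 w0 = 1 by rewrite !hhE h0 -expgzD subrr.
have ell_rep y : act (ell y) (vrep (qt y)) = vrep (qs y).
  by rewrite /vrep /= !orb_rep_eq /ell !lactM !expgzN !lactVK.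
have h_rep z : act (h z) w0 = vrep z.
  move: z; apply: T'conn => [|y /hT ->]; first by rewrite h0 /vrep /= orb_rep_eq.
  rewrite lactM -ell_rep; split=> [|-> //].
  by move/(can_inj (lactK act (ell y))).
have hh_w0 v w : act (hh v w) w0 = w.
  by rewrite hhE lactM h_rep; apply: (orb_repK (D v)).
(* The loop at [w0] that goes to [w] through its edge orbit: the three factors lead from [w0] to
   [(tau e)^-1 w], then to [w], then back to [w0]. *)
pose yy e w : G := (hh (s e) w)^-1 * tau e * hh (t e) (act (tau e)^-1 w).
have yy_act e k w : yy e (act (expgz (expgz (a (s e)) (lam e)) k) w) = yy e w.
  rewrite /yy -lactM tau_conj lactM -!expgzM !hh_act invgM.
  rewrite -!mulgA; congr (_ * _); rewrite (mulgA (tau e)).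
  have -> : tau e * expgz (a (t e)) (mu e * k)%R = expgz (a (s e)) (lam e * k)%R * tau e.
    by rewrite !expgzM; apply: conj_expgz; case: (gbs_rel pres).
  by rewrite -mulgA mulKg.
have yy_rep e w : yy e w = yy e (erep (ecls e w)).
  by rewrite /erep /= orb_rep_eq yy_act.
have yyT y : y \in T' -> yy (tag y) (erep y) = 1.
  move=> /hT; rewrite /yy !hhE -/(qs y) -/(qt y) => ->.
  rewrite /ell !expgzN invgM invgM !invgM invgK -!mulgA.
  by rewrite mulVKg !mulKg mulVg.
have yy_stab e w : act (yy e w) w0 = w0.
  by rewrite /yy 2!lactM hh_w0 lactVK -{2}(hh_w0 (s e) w) lactK.
pose psi : X -> G := free_lift (fun i : 'I_r => yy (tag (enum_val i)) (erep (enum_val i))).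
have psiM : is_hom psi by apply: free_lift_hom.
have psi_x y : psi (x y) = yy (tag y) (erep y).
  have [yT|yB] := boolP (y \in T'); first by rewrite xT // yyT // is_hom1.
  have yB' : y \in B by rewrite finset.in_setC.
  by rewrite -(enum_rankK_in yB' yB') x_enum /psi /bgen free_lift_gen.
pose xe e w : X := x (ecls e w).
have psi_xe e w : psi (xe e w) = yy e w.
  by rewrite /xe psi_x -[tag _]/e -yy_rep.
(* Over each point [w], a potential on the vertices, normalised at [v0], absorbs the labels [xe e w]
   along [T]; lifted stable letters can then be trivial on [T]. *)
have /boolp.choice[gg gg0] w : exists g : V -> X, g v0 = 1 /\
    forall e, e \in T -> g (s e) = g (t e) * (xe e w)^-1.
  have [p [p0 pT]] := gbs_gauges pres
    (f := fun e z => z * (xe e w)^-1) (f' := fun e z => z * xe e w) 1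
    (fun e => mulgK (xe e w)).
  by exists p; split.
pose W : groupType := wreath act X.
pose kap v : W := wreath_base act (fun w => gg w v).
pose iota g : W := wreath_top act X g.
have iotaM : is_hom iota by apply: wreath_top_hom.
(* Lifts of the generators to the wreath product, with [xe] inserted at the edges and the potentials
   [kap] as changes of base point. The edge relations survive because [xe e] is constant on the
   orbits of the edge group. *)
pose ag v : W := kap v * iota (a v) * (kap v)^-1.
pose taug e : W := kap (s e) * wreath_base act (xe e) * iota (tau e) * (kap (t e))^-1.
have agX v k : expgz (ag v) k = kap v * iota (expgz (a v) k) * (kap v)^-1.
  apply: (mulIg (kap v)); rewrite mulgVK (is_hom_expgz iotaM).
  by apply/esym/conj_expgz; rewrite /ag mulgVK.
have relW : gbs_relations s t T lam mu ag taug.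
  split=> [e|e eT]; last first.
    rewrite /taug relT // (is_hom1 iotaM) mulg1 wreath_baseM.
    have -> : (fun w => gg w (s e) * xe e w) = (fun w => gg w (t e)).
      by apply/funext => w; have [_ ->] := gg0 w; rewrite ?mulgVK.
    exact: mulgV.
  rewrite !agX /taug -!mulgA mulKg; congr (_ * _).
  rewrite mulKg (mulgA (iota (tau e))) -iotaM.
  have [-> _] := gbs_rel pres; rewrite iotaM !mulgA wreath_base_top // => w.
  by rewrite /xe -{1}(expgz1 (expgz _ _)) quotient_ecls_act.
have [f [fM fa ftau]] := gbs_univ pres relW.
have f2 g : (f g).2 = g.
  move: g; apply: (gbs_gen pres).
  - by split=> [|g k fg fk|g fg]; rewrite ?is_hom1 ?fM ?is_homV //= ?fg ?fk.
  - by move=> v; rewrite fa /= mul1g invg1 mulg1.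
  - by move=> e; rewrite ftau /= !mul1g invg1 mulg1.
pose c g w : X := (f g).1 w.
have cM g k w : c (g * k) w = c g (act k w) * c k w.
  by rewrite /c fM wreath_mulE /= f2.
have c1 w : c 1 w = 1 by rewrite /c is_hom1.
have cV g w : c g^-1 w = (c g (act g^-1 w))^-1.
  by apply: (mulgI (c g (act g^-1 w))); rewrite -cM !mulgV c1.
have ca v w : c (a v) w = gg (act (a v) w) v * (gg w v)^-1.
  by rewrite /c fa /ag wreath_baseV /= !lact1 mulg1.
have ctau e w : c (tau e) w =
    gg (act (tau e) w) (s e) * xe e (act (tau e) w) * (gg w (t e))^-1.
  by rewrite /c ftau /taug wreath_baseV /= !lact1 mulg1.
have caX v k w : c (expgz (a v) k) w = gg (act (expgz (a v) k) w) v * (gg w v)^-1.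
  rewrite /c (is_hom_expgz fM) fa agX wreath_baseV /= !lact1 mulg1 //.
have psi_gg v w : psi (gg w v) = (hh v0 w)^-1 * hh v w.
  move: v; apply: (gbs_tree pres); first by rewrite (gg0 w).1 is_hom1 // mulVg.
  move=> e eT; rewrite (gg0 w).2 // psiM is_homV // psi_xe.
  rewrite /yy relT // invg1 lact1 mulg1 invgM invgK.
  split=> [e1|->]; last by rewrite mulgA mulgK.
  apply: (mulIg ((hh (t e) w)^-1 * hh (s e) w)); rewrite e1.
  by rewrite -!mulgA mulVKg.
(* Thus [psi] recovers [g] from its cocycle up to the transversal, and exactly when [g] fixes [w0],
   because [hh v0 w0 = 1]. *)
have psi_c g w : psi (c g w) = (hh v0 (act g w))^-1 * g * hh v0 w.
  move: g w; apply: (gbs_gen pres).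
  - split=> [w|g k IHg IHk w|g IH w].
    + by rewrite c1 lact1 mulg1 mulVg is_hom1.
    + by rewrite cM psiM IHg IHk lactM -!mulgA mulVKg.
    + by rewrite cV is_homV // IH lactVK !invgM invgK mulgA.
  - move=> v w; rewrite ca psiM is_homV // !psi_gg.
    have := hh_act v 1%R w; rewrite !expgz1 => ->.
    by rewrite invgM invgK -!mulgA mulVKg.
  - move=> e w; rewrite ctau !psiM is_homV // !psi_gg psi_xe /yy lactK.
    by rewrite invgM invgK -!mulgA !mulVKg.
(* On tree edges [x y = 1], so the cocycle of [ell y] is a coboundary of [gg]; this propagates the
   next formula along [T']. *)
have c_ell y : y \in T' -> c (ell y) (vrep (qt y)) =
    gg (vrep (qs y)) (s (tag y)) * (gg (vrep (qt y)) (t (tag y)))^-1.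
  move=> yT; rewrite -ell_rep /ell.
  set q := vrep (qt y); set A := expgz _ (- _)%R; set C := expgz (a (t _)) _.
  have uC : act C q = act (tau (tag y))^-1 (erep y).
    by rewrite /q /vrep /= orb_rep_eq expgzN lactVK.
  rewrite !cM uC ctau lactVK !caX uC /xe ecls_erep xT // mulg1.
  by rewrite !lactM uC lactVK !mulgA !mulgVK.
have c_hh v w : c (hh v w) w0 = gg w v.
  suff hx : forall z : QV, c (h z) w0 = gg (vrep z) (tag z).
    rewrite hhE cM hx caX h_rep /= mulgVK [act _ _](orb_repK (D v)) //.
  apply: T'conn => [|y yT].
    by rewrite h0 caX /vrep /= orb_rep_eq (gg0 w0).1 invg1 mulg1.
  rewrite (hT _ yT) cM h_rep c_ell //=; split=> [e1|->]; last by rewrite mulgVK.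
  by apply: (mulgI (gg (vrep (qs y)) (s (tag y)) * (gg (vrep (qt y)) (t (tag y)))^-1));
    rewrite e1 mulgVK.
have c_yy e w : c (yy e w) w0 = xe e w.
  rewrite /yy !cM hh_w0 cV ctau lactVK c_hh.
  have -> : act (hh (s e) w)^-1 w = w0 by rewrite -{2}(hh_w0 (s e) w) lactK.
  by rewrite c_hh !mulgA mulVg mul1g mulgVK.
have psi_stab u : act (psi u) w0 = w0.
  move: u; apply: free_group_ind => [|i]; last by rewrite /psi free_lift_gen.
  split=> [|u v su sv|u su]; first by rewrite is_hom1 // lact1.
    by rewrite psiM lactM sv.
  by rewrite is_homV // -{1}su lactK.
have c_psi u : c (psi u) w0 = u.
  apply: (free_hom_ext (f := fun u => c (psi u) w0) (g := id)) => // [u' v|i].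
    by rewrite psiM cM psi_stab.
  by rewrite /psi free_lift_gen c_yy /xe ecls_erep x_enum.
exists r, psi; split=> //.
(* The edges outside a spanning tree number |QE| - (|QV| - 1). *)
- by have := finset.cardsC T'; rewrite /r /B; move: cT'; lia.
- exact: (can_inj (g := fun g => c g w0) c_psi).
- move=> g; split=> [[u <-] //|gw0]; exists (c g w0).
  by rewrite psi_c gw0 hh0 invg1 mulg1 mul1g.
Qed.

End FreeStabilizer.

(** * Counting orbits *)

Section OrbitCounting.
Variables (G : groupType) (Omega : Type) (act : left_action G Omega).
Implicit Types (g : G) (k : int).

Lemma free_orbits_fin (A : int -> Omega -> Omega) (R : finType)
    (rep : R -> Omega) (cls : Omega -> R) (pos : Omega -> int) :
  (forall w, A (pos w) (rep (cls w)) = w) ->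
  (forall i k, cls (A k (rep i)) = i) -> (forall i k, pos (A k (rep i)) = k) ->
  free_orbits A #|R|.
Proof.
move=> repK clsA posA; split.
apply: (@OrbitData _ A #|R| (fun i => rep (enum_val i))
  (fun w => enum_rank (cls w)) pos) => [w|i k|i k]; rewrite ?posA //.
  by rewrite enum_rankK.
by rewrite clsA enum_valK.
Qed.

Lemma free_orbits_free g n : free_orbits (zact act g) n ->
  forall k w, act (expgz g k) w = w -> k = 0%R.
Proof.
by case=> D k w e; have := orb_pos_act D k w; rewrite e; lia.
Qed.

(** The first index whose point lies in the orbit of [w] depends only on that orbit; the indices
    selected by their own point enumerate the orbits. *)
Lemma free_orbits_exist g (R : finType) (x : R -> Omega) :
  (forall k w, act (expgz g k) w = w -> k = 0%R) ->
  (forall w, exists k i, act (expgz g k) (x i) = w) ->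
  exists n, free_orbits (zact act g) n.
Proof.
move=> gfree gcov.
pose P w i := `[< exists k, act (expgz g k) (x i) = w >].
have Pact k w : P (act (expgz g k) w) =1 P w.
  move=> i; apply/asboolP/asboolP => -[l e].
    exists (l - k)%R; rewrite addrC expgzD lactM e -lactM -expgzD addNr lact1 //.
  by exists (k + l)%R; rewrite expgzD lactM e.
have cP w : exists i, [pick i | P w i] = Some i.
  case: pickP => [i|noP]; first by exists i.
  by have [k [i e]] := gcov w; have /negP[] := negbT (noP i); apply/asboolP; exists k.
have [c cE] := boolp.choice cP.
have c_act k w : c (act (expgz g k) w) = c w.
  by apply: Some_inj; rewrite -!cE; apply: eq_pick.
have Pc w : P w (c w) by move: (cE w); case: pickP => // i Pi [<-].
have xc w : exists k, act (expgz g k) (x (c w)) = w by apply/asboolP/Pc.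
have [pos posE] := boolp.choice xc.
have cc w : c (x (c w)) == c w.
  have -> : x (c w) = act (expgz g (- pos w)%R) w.
    by rewrite -{3}(posE w) -lactM -expgzD addNr lact1.
  by rewrite c_act.
pose R' : finType := {i : R | c (x i) == i}.
exists #|R'|; apply: (@free_orbits_fin (zact act g) R' (fun i => x (val i))
  (fun w => exist _ (c w) (cc w)) pos) => [w|i k|i k].
- exact: posE.
- by apply: val_inj; rewrite /= c_act; apply/eqP/(valP i).
- apply/eqP; rewrite -subr_eq0; apply/eqP/(gfree _ (x (val i))).
  have := posE (zact act g k (x (val i))).
  rewrite {2}/zact c_act (eqP (valP i)) => e.
  by rewrite addrC expgzD lactM e -lactM -expgzD addNr lact1.
Qed.

(** The representatives of one decomposition lie in distinct classes of the other. *)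
Lemma free_orbits_uniq g m n :
  free_orbits (zact act g) m -> free_orbits (zact act g) n -> m = n.
Proof.
suff le p q : free_orbits (zact act g) p -> free_orbits (zact act g) q -> (p <= q)%N.
  by move=> hm hn; apply/eqP; rewrite eqn_leq !le.
case=> Dp [Dq]; rewrite -(card_ord p) -(card_ord q).
apply: (leq_card (fun i => orb_cls Dq (orb_rep Dp i))) => i j eij.
have clsK l : orb_cls Dp (orb_rep Dp l) = l.
  by rewrite -{2}(orb_clsA Dp l 0%R) /zact lact1.
have := orb_repK Dq (orb_rep Dp i); rewrite eij orb_rep_eq /zact -lactM -expgzD => e.
by rewrite -(clsK i) -e orb_cls_act clsK.
Qed.

(** Each orbit of [g] splits according to the residue of the position modulo [k]. *)
Lemma free_orbits_pow g n k : k != 0%R -> free_orbits (zact act g) n ->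
  free_orbits (zact act (expgz g k)) (`|k| * n)%N.
Proof.
move=> k0 [D]; have k_gt0 : (0 < `|k|)%N by rewrite absz_gt0.
have mod_lt w : (`|(orb_pos D w %% k)%Z| < `|k|)%N.
  by have := ltz_mod (orb_pos D w) k0; have := modz_ge0 (orb_pos D w) k0; lia.
have lt_ord (j : 'I_(`|k|)) : (0 <= j%:Z < `|k|)%R.
  by rewrite -abszE lez_nat ltz_nat leq0n ltn_ord.
have posE (j : nat) i l :
    orb_pos D (zact act (expgz g k) l (act (expgz g j%:Z) (orb_rep D i))) =
    (l * k + j%:Z)%R.
  rewrite /zact -expgzM -lactM -expgzD mulrC; exact: (orb_posA D).
have -> : (`|k| * n)%N = #|{: 'I_(`|k|) * 'I_n}| by rewrite card_prod !card_ord.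
apply: (@free_orbits_fin (zact act (expgz g k)) ('I_(`|k|) * 'I_n)%type
  (fun r => act (expgz g r.1%:Z) (orb_rep D r.2))
  (fun w => (Ordinal (mod_lt w), orb_cls D w))
  (fun w => (orb_pos D w %/ k)%Z)) => [w|[j i] l|[j i] l] /=.
- have m_ge0 := modz_ge0 (orb_pos D w) k0.
  rewrite /zact -expgzM -lactM -[g ^+ _]/(expgz g (Posz _)) -expgzD.
  have -> : (k * (orb_pos D w %/ k)%Z + `|(orb_pos D w %% k)%Z|%N%:Z = orb_pos D w)%R.
    by rewrite [RHS](divz_eq _ k) mulrC gez0_abs.
  exact: (orb_repK D).
- rewrite -[g ^+ j]/(expgz g j%:Z).
  congr pair; last by rewrite /zact -expgzM !orb_cls_act -{2}(orb_clsA D i 0%R) /zact lact1.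
  by apply: val_inj; rewrite /= posE modzMDl -modz_abs modz_small //; apply: lt_ord.
- by rewrite -[g ^+ j]/(expgz g j%:Z) posE divzMDl // divz_small ?addr0 //; apply: lt_ord.
Qed.

(** Representatives for [expgz g k] meet every orbit of [g], and an element fixed by a power of [g]
    is fixed by the [k]-th power of that power; the count follows from uniqueness. *)
Lemma free_orbits_root g m k : k != 0%R -> free_orbits (zact act (expgz g k)) m ->
  exists n, free_orbits (zact act g) n /\ m = (`|k| * n)%N.
Proof.
move=> k0 fo; have [n fon] : exists n, free_orbits (zact act g) n.
  case: (fo) => D; apply: (@free_orbits_exist _ 'I_m (orb_rep D)) => [l w e|w].
    have := free_orbits_free fo (k := l) (w := w); apply.
    rewrite -expgzM; elim/int_ind: k {k0 fo D} => [|k IH|k IH].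
    - by rewrite mul0r lact1.
    - have -> : (k.+1%:Z * l = k%:Z * l + l)%R by lia.
      by rewrite expgzD lactM e.
    - have -> : (- k.+1%:Z * l = - k%:Z * l - l)%R by lia.
      by rewrite expgzD lactM expgzN -{1}e lactK.
  exists (k * orb_pos D w)%R, (orb_cls D w).
  by rewrite expgzM; apply: (orb_repK D).
exists n; split=> //; apply: free_orbits_uniq fo _; exact: free_orbits_pow.
Qed.

Lemma free_orbits_eq g h n : (forall k w, act (expgz g k) w = act (expgz h k) w) ->
  free_orbits (zact act g) n -> free_orbits (zact act h) n.
Proof.
move=> gh; suff -> : zact act h = zact act g by [].
by apply/funext => k; apply/funext => w; rewrite /zact gh.
Qed.

End OrbitCounting.

Section StabilizerRank.
Variables (V E : finType) (s t : E -> V) (T : {set E}) (lam mu : E -> int) (v0 : V).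
Variables (G : groupType) (a : V -> G) (tau : E -> G).
Hypothesis pres : gbs_presentation s t T lam mu v0 a tau.
Variables (Omega : Type) (act : left_action G Omega) (w0 : Omega).

Lemma card_sigma_ord (I : finType) (n : I -> nat) :
  #|{: {i : I & 'I_(n i)}}| = (\sum_i n i)%N.
Proof.
rewrite card_tagged sumnE big_map big_enum /=.
by apply: eq_bigr => i _; rewrite card_ord.
Qed.

(** The edge group of [e] is generated by a power of [a (s e)], so its orbits number
    [|lam e| * n (s e)]; the rank is read off the Euler characteristic of the orbit graph. *)
Theorem stabilizer_free (n : V -> nat) :
  (forall w, exists g, act g w0 = w) ->
  (forall v, free_orbits (zact act (a v)) (n v)) ->
  exists r (i : free_group_of_rank r -> G),
  [/\ (r + \sum_v n v = \sum_e `|lam e| * n (s e) + 1)%N, is_hom i, injective i &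
      forall g, (exists u, i u = g) <-> act g w0 = w0].
Proof.
move=> trans fo; have [D] := inhabited_forall fo.
have foE e : free_orbits (zact act (expgz (a (s e)) (lam e))) (`|lam e| * n (s e)).
  by apply: free_orbits_pow; [exact: (gbs_lam pres)|].
have [DE] := inhabited_forall foE.
have [r [i [er iM i_inj i_stab]]] := stabilizer_free_data pres trans D DE.
by exists r, i; split=> //; rewrite -!card_sigma_ord.
Qed.

End StabilizerRank.

(** * Actions by translations and on cosets *)

Section Translations.
Variables (G : groupType) (phi : G -> infinite_cyclic_group).
Hypothesis phiM : is_hom phi.

Definition translation : left_action G int.
Proof.
refine (@LeftAction G int (fun g w => ((phi g : int) + w)%R) _ _) => [w|g h w].
  by rewrite is_hom1 // add0r.
by rewrite phiM cyclic_mulE addrA.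
Defined.

(** An element of height 1 has a single free orbit, and [g] acts as its power of exponent
    [phi g]. *)
Lemma translation_free_orbits : surjective phi -> forall g, (phi g : int) != 0%R ->
  free_orbits (zact translation g) `|phi g : int|%N.
Proof.
move=> phi_surj g g0; have [x x1] := phi_surj (1%R : int).
have -> : `|phi g : int|%N = (`|phi g : int| * 1)%N by rewrite muln1.
apply: (@free_orbits_eq _ _ _ (expgz x (phi g : int))).
  by move=> k w /=; rewrite !is_hom_expgz // !cyclic_expgzE x1 mul1r.
apply: free_orbits_pow => //; split.
apply: (@OrbitData _ _ _ (fun=> 0%R) (fun=> ord0) id) => [w|i k|i k].
- by rewrite /zact /= is_hom_expgz // cyclic_expgzE x1 mul1r addr0.
- by rewrite (ord1 i).
- by rewrite /zact /= is_hom_expgz // cyclic_expgzE x1 mul1r addr0.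
Qed.

End Translations.

Section Cosets.
Variables (G : groupType) (S : G -> Prop).
Hypothesis Ssub : is_subgroup S.

(** Cosets are predicates, so that equal cosets are equal points by extensionality. *)
Definition coset_space := {A : G -> Prop | exists g, A = fun x => S (g^-1 * x)}.
Definition left_coset g : coset_space :=
  exist _ (fun x => S (g^-1 * x)) (ex_intro _ g erefl).

Lemma left_cosetP g h : left_coset g = left_coset h <-> S (g^-1 * h).
Proof.
have [S1 SM SV] := Ssub; split=> [[/(congr1 (@^~ h))] ->|Sgh].
  by rewrite mulVg.
apply: eq_exist => /=; apply/funext => x; apply/propext; split=> Sx.
  by have := SM _ _ (SV _ Sgh) Sx; rewrite invgM invgK -mulgA mulVKg.
by have := SM _ _ Sgh Sx; rewrite -mulgA mulVKg.
Qed.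

Lemma left_coset_surj (w : coset_space) : exists g, left_coset g = w.
Proof. by case: w => A [g e]; exists g; apply: eq_exist. Qed.

Let crep w := sval (cid (left_coset_surj w)).
Let crepK w : left_coset (crep w) = w. Proof. exact: (svalP (cid (left_coset_surj w))). Qed.
Let cact g w := left_coset (g * crep w).

Lemma cactE g h : cact g (left_coset h) = left_coset (g * h).
Proof.
have /left_cosetP e := crepK (left_coset h).
by apply/left_cosetP; rewrite invgM -mulgA mulKg.
Qed.

Definition coset_action : left_action G coset_space.
Proof.
refine (@LeftAction G coset_space cact _ _) => [w|g h w].
  by rewrite -(crepK w) cactE mul1g.
by rewrite -(crepK w) !cactE mulgA.
Defined.

Lemma coset_actionE g h : coset_action g (left_coset h) = left_coset (g * h).
Proof. exact: cactE. Qed.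

End Cosets.

(** * Presentations of GBS groups *)

Definition hom_kernel (G H : groupType) (f : G -> H) (fM : is_hom f) :
  normal_subgroup G.
Proof.
refine (@NormalSubgroup G (fun x => f x = 1) (is_hom1 fM) _ _ _).
- by move=> x y fx fy; rewrite fM fx fy mulg1.
- by move=> x fx; rewrite is_homV // fx invg1.
- by move=> x y fx; rewrite conjgE !fM fx mul1g -fM mulVg is_hom1.
Defined.

Section QuotientMaps.
Variables (G : groupType) (N : normal_subgroup G).

Lemma to_quotient_hom : is_hom (to_quotient N).
Proof. by move=> x y; rewrite -quotient_mulE. Qed.

Lemma to_quotient_eq1 x : to_quotient N x = 1 <-> N x.
Proof.
split=> [e|Nx]; first by have /to_quotientP := esym e; rewrite invg1 mul1g.
by apply/esym/to_quotientP; rewrite invg1 mul1g.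
Qed.

Lemma to_quotient_surj : surjective (to_quotient N).
Proof. by move=> u; exists (quotient_repr u); apply: quotient_reprK. Qed.

Lemma quotient_lift (H : groupType) (f : G -> H) : is_hom f ->
  (forall x, N x -> f x = 1) -> exists f' : quotient_group N -> H,
  is_hom f' /\ forall x, f' (to_quotient N x) = f x.
Proof.
move=> fM fN; pose f' (u : quotient_group N) := f (quotient_repr u).
have f'E x : f' (to_quotient N x) = f x.
  apply: (mulgI (f' (to_quotient N x))^-1); rewrite mulVg /f' -(is_homV fM) -fM.
  by apply/esym/fN/to_quotientP/quotient_reprK.
exists f'; split=> // u v.
have [x <-] := to_quotient_surj u; have [y <-] := to_quotient_surj v.
by rewrite -to_quotient_hom !f'E fM.
Qed.

End QuotientMaps.

Lemma normal_closure_sub (G : groupType) (R : set G) x : R x -> normal_closure R x.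
Proof. by move=> Rx N; apply. Qed.

Section GBSPresentation.

Lemma connecting_graph_connected (Y : graph_of_groups) (T : {set edge Y}) v0 :
  connecting T -> graph_connected (@source Y) (@target Y) T v0.
Proof.
move=> Tc P P0 PT v; have /connectP[p pth ->] := Tc v0 v.
elim: p v0 P0 pth => //= w p IH u Pu /andP[/existsP[e] /andP[eT uw] pth].
apply: IH pth; case/orP: uw => /andP[/eqP su /eqP tw].
  by rewrite -tw; apply/(PT e eT); rewrite su.
by rewrite -su; apply/(PT e eT); rewrite tw.
Qed.

Lemma cyclic_log (C : groupType) : isomorphic C infinite_cyclic_group ->
  exists (log : C -> infinite_cyclic_group) (gen : C),
    [/\ is_hom log, injective log & log gen = (1%R : int)].
Proof.
case=> f /[dup] /bij_inj f_inj [g fK gK].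
by exists f, (g (1%R : int)); split; [exact: ghom_is_hom|exact: f_inj|exact: gK].
Qed.

Lemma cyclic_logK (C : groupType) (log : C -> infinite_cyclic_group) gen :
  is_hom log -> injective log -> log gen = (1%R : int) ->
  forall x, x = expgz gen (log x : int).
Proof.
move=> lM l_inj lg x; apply: l_inj; rewrite is_hom_expgz // lg.
by rewrite cyclic_expgzE mul1r.
Qed.

(** A generator is chosen in every vertex and edge group; [lam e] and [mu e] are the exponents of
    the two images of the edge generator. *)
Theorem GBS_has_presentation (G : groupType) : GBS_group G ->
  exists (V E : finType) (s t : E -> V) (T : {set E}) (lam mu : E -> int) (v0 : V)
    (a : V -> G) (tau : E -> G), gbs_presentation s t T lam mu v0 a tau.
Proof.
case=> Y [T [[/card_gt0P[v0 _] _] [Tc cT] vcyc ecyc [F F_bij]]].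
have FM := ghom_is_hom F; case: (F_bij) => F' FK F'K.
have F'M : is_hom F' by move=> x y; apply: (can_inj FK); rewrite FM !F'K.
pose vdat v := cid (cyclic_log (vcyc v)); pose edat e := cid (cyclic_log (ecyc e)).
pose vlog v := sval (vdat v); pose elog e := sval (edat e).
pose vgen v := sval (cid (svalP (vdat v))); pose egen e := sval (cid (svalP (edat e))).
have vP v : [/\ is_hom (vlog v), injective (vlog v) & vlog v (vgen v) = (1%R : int)].
  exact: (svalP (cid (svalP (vdat v)))).
have eP e : [/\ is_hom (elog e), injective (elog e) & elog e (egen e) = (1%R : int)].
  exact: (svalP (cid (svalP (edat e)))).
have vK v x : x = expgz (vgen v) (vlog v x : int).
  by have [? ? ?] := vP v; apply: cyclic_logK.
have eK e x : x = expgz (egen e) (elog e x : int).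
  by have [? ? ?] := eP e; apply: cyclic_logK.
pose lam e : int := vlog _ (source_map e (egen e)).
pose mu e : int := vlog _ (target_map e (egen e)).
pose N := normal_closure (pi1_relator T); pose pi := to_quotient N.
have piM : is_hom pi by apply: to_quotient_hom.
have rel1 r : pi1_relator T r -> pi r = 1.
  by move=> Rr; apply/to_quotient_eq1/normal_closure_sub.
pose vl v (g : vertex_group v) := pi (vertex_letter g).
have vlM v : is_hom (@vl v).
  move=> g h; have := rel1 _ (VertexRelator T g h).
  by rewrite !piM (is_homV piM) => /eqP; rewrite divg_eq1 => /eqP.
have vlE v g : @vl v g = expgz (vl v (vgen v)) (vlog v g : int).
  by rewrite {1}(vK v g) is_hom_expgz.
pose a v := F' (vl v (vgen v)); pose tau e := F' (pi (stable_letter e)).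
have emap_neq0 e (C : groupType) (f : {ghom edge_group e -> C}) (lg : C -> infinite_cyclic_group) :
    injective f -> is_hom lg -> injective lg -> (lg (f (egen e)) : int) != 0%R.
  move=> f_inj lM l_inj; have [eM e_inj eg] := eP e; apply/eqP => l0.
  have g1 : egen e = 1.
    apply: f_inj; rewrite is_hom1; last exact: ghom_is_hom.
    by apply: l_inj; rewrite is_hom1 // l0.
  by move: eg; rewrite g1 is_hom1.
exists (vertex Y), (edge Y), (@source Y), (@target Y), T, lam, mu, v0, a, tau.
split=> //.
- exact: connecting_graph_connected.
- move=> e; have [? ? _] := vP (source e).
  by apply: emap_neq0 => //; apply: source_map_inj.
- move=> e; have [? ? _] := vP (target e).
  by apply: emap_neq0 => //; apply: target_map_inj.
- split=> [e|e eT]; last by rewrite /tau rel1 ?is_hom1 //; apply: TreeRelator.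
  rewrite /tau /a -!is_hom_expgz // -!F'M; congr F'.
  have := rel1 _ (EdgeRelator T (egen e)).
  rewrite !piM !(is_homV piM) => /eqP; rewrite divg_eq1 => /eqP.
  by move=> er; rewrite /lam /mu -!vK /vl -er mulgVK.
- move=> P [P1 PM PV] Pa Pt g; rewrite -(FK g).
  have [w <-] := to_quotient_surj (F g); move: w; apply: free_group_ind.
    split; first by rewrite -/pi !is_hom1.
      by move=> x y Px Py; rewrite -/pi piM F'M; apply: PM.
    by move=> x Px; rewrite -/pi !is_homV //; apply: PV.
  case=> [[v x]|e]; last exact: Pt.
  rewrite -[to_quotient _ _]/(@vl v x) vlE is_hom_expgz //.
  by apply: is_subgroup_expgz; [split | exact: Pa].
- move=> X a' tau' [rel' tree'].
  (* An element of a vertex group goes to the power of [a' v] given by its logarithm. *)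
  pose h (x : pi1_generator Y) : X := match x with
    | inl (existT v g) => expgz (a' v) (vlog v g : int)
    | inr e => tau' e end.
  have hM := free_lift_hom h.
  have hv v (g : vertex_group v) :
      free_lift h (vertex_letter g) = expgz (a' v) (vlog v g : int).
    by rewrite /vertex_letter free_lift_gen.
  have hs e : free_lift h (stable_letter e) = tau' e by rewrite free_lift_gen.
  have hN x : N x -> free_lift h x = 1.
    move=> /(_ (hom_kernel hM)); apply=> r [v g k|e c|e eT] /=.
    + have [vM _ _] := vP v.
      by rewrite !hM (is_homV hM) !hv vM cyclic_mulE expgzD mulgV.
    + have [sM _ _] := vP (source e); have [tM _ _] := vP (target e).
      rewrite !hM !(is_homV hM) !hv !hs (eK e c).
      rewrite !(is_hom_expgz (@ghom_is_hom _ _ _)).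
      rewrite (is_hom_expgz sM) (is_hom_expgz tM) !cyclic_expgzE.
      rewrite -/(lam e) -/(mu e) !expgzM (conj_expgz _ (rel' e)).
      by rewrite mulgK mulgV.
    + by rewrite hs tree'.
  have [f [fM fE]] := quotient_lift hM hN.
  exists (fun g => f (F g)); split.
  + by move=> x y; rewrite FM fM.
  + move=> v; rewrite /a F'K /vl /pi fE hv; have [_ _ ->] := vP v.
    by rewrite expgz1.
  + by move=> e; rewrite /tau F'K /pi fE hs.
Qed.

End GBSPresentation.

(** * The affine group of the rational line *)

(** The pair (x, y) stands for the map u |-> x u + y. *)
Definition affine : Type := {p : rat * rat | p.1 != 0%R}.
HB.instance Definition _ := Choice.on affine.

Section AffineGroup.
Local Open Scope ring_scope.

Definition aff (x : rat) (hx : x != 0) (y : rat) : affine :=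
  exist (fun p : rat * rat => p.1 != 0) (x, y) hx.

Lemma affP (f g : affine) : (val f).1 = (val g).1 -> (val f).2 = (val g).2 -> f = g.
Proof. by case: f g => [[x y] hx] [[x' y'] hx'] /= e e'; apply: val_inj; rewrite /= e e'. Qed.

Lemma aff_mul_neq0 (f g : affine) : (val f).1 * (val g).1 != 0.
Proof. by rewrite mulf_neq0 ?(valP f) ?(valP g). Qed.
Lemma aff_inv_neq0 (f : affine) : (val f).1^-1 != 0.
Proof. by rewrite invr_eq0 (valP f). Qed.

Definition aff_one : affine := aff (oner_neq0 _) 0.
Definition aff_mul (f g : affine) : affine :=
  aff (aff_mul_neq0 f g) ((val f).1 * (val g).2 + (val f).2).
Definition aff_inv (f : affine) : affine :=
  aff (aff_inv_neq0 f) (- ((val f).1^-1 * (val f).2)).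

Lemma aff_mulA : associative aff_mul.
Proof. by move=> f g h; apply: affP => /=; rewrite ?mulrA // mulrDr addrA mulrA. Qed.
Lemma aff_mul1 : left_id aff_one aff_mul.
Proof. by move=> f; apply: affP; rewrite /= ?mul1r ?addr0. Qed.
Lemma aff_mulr1 : right_id aff_one aff_mul.
Proof. by move=> f; apply: affP; rewrite /= ?mulr1 ?mulr0 ?add0r. Qed.
Lemma aff_mulV : left_inverse aff_one aff_inv aff_mul.
Proof. by move=> f; apply: affP; rewrite /= ?mulVf ?(valP f) ?subrr. Qed.
Lemma aff_mulrV : right_inverse aff_one aff_inv aff_mul.
Proof.
move=> f; apply: affP; rewrite /= ?mulfV ?(valP f) //.
by rewrite mulrN mulrA mulfV ?(valP f) // mul1r addNr.
Qed.

HB.instance Definition _ := isGroup.Build affine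
  aff_mulA aff_mul1 aff_mulr1 aff_mulV aff_mulrV.

Lemma aff_mulE (f g : affine) : (f * g)%g = aff_mul f g. Proof. by []. Qed.

Lemma aff_translationX y k :
  expgz (aff (oner_neq0 _) y) k = aff (oner_neq0 _) (y * k%:~R).
Proof.
elim/int_ind: k => [|n IH|n IH].
- by apply: affP; rewrite //= mulr0.
- have -> : (n.+1%:Z = n%:Z + 1) by lia.
  by rewrite expgzS IH; apply: affP; rewrite /= ?mul1r // intrD mulrDr mulr1 addrC.
- have -> : (- n.+1%:Z = - n%:Z - 1) by lia.
  rewrite expgzD IH; apply: affP; rewrite /= ?invr1 ?mul1r //.
  by rewrite intrD mulrDr mulrN1 addrC.
Qed.

Lemma aff_homothetyX x (hx : x != 0) (n : nat) :
  (val ((aff hx 0 : affine) ^+ n)%g).1 = x ^+ n /\ (val ((aff hx 0 : affine) ^+ n)%g).2 = 0.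
Proof.
elim: n => [//|n [IH1 IH2]]; rewrite expgS aff_mulE /= IH1 IH2 mulr0 addr0.
by rewrite exprS.
Qed.

End AffineGroup.

(** * Finite index, independence and fibers *)

(** [N] is the least positive element; Euclidean division does the rest. *)
Lemma int_subgroup (P : int -> Prop) x : P 0%R ->
  (forall u v, P u -> P v -> P (u - v)%R) -> P x -> x != 0%R ->
  exists N : nat, [/\ (0 < N)%N, P (Posz N) & forall u, P u -> exists k, u = (k * (Posz N))%R].
Proof.
move=> P0 PB Px x0.
have PN u : P u -> P (- u)%R by rewrite -sub0r; apply: PB.
have PD u v : P u -> P v -> P (u + v)%R by move=> Pu /PN; rewrite -{2}(opprK v); apply: PB.
have PM u k : P u -> P (u * k)%R.
  move=> Pu; elim/int_ind: k => [|n IH|n IH]; first by rewrite mulr0.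
    have -> : (u * n.+1%:Z = u * n%:Z + u)%R by lia.
    exact: PD.
  have -> : (u * (- n.+1%:Z) = u * (- n%:Z) - u)%R by lia.
  exact: PB.
have ex : exists n, (0 < n)%N && `[< P (Posz n) >].
  exists `|x|%N; rewrite absz_gt0 x0; apply/asboolP; rewrite abszE.
  by case: (ger0P x) => _; [|apply: PN].
case: (ex_minnP ex) => N /andP[N0 /asboolP PN'] Nmin; exists N; split=> // u Pu.
exists (u %/ (Posz N))%Z; rewrite {1}(divz_eq u (Posz N)).
have N0' : (Posz N) != 0%R by lia.
have Pm : P (u %% (Posz N))%Z by rewrite /modz mulrC; apply: PB => //; apply: PM.
have m0 := modz_ge0 u N0'; have mN := ltz_mod u N0'.
have [m_eq0|m_neq0] := eqVneq (u %% (Posz N))%Z 0%R; first by rewrite m_eq0 addr0.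
have : (N <= `|(u %% (Posz N))%Z|)%N.
  by apply: Nmin; rewrite absz_gt0 m_neq0; apply/asboolP; rewrite gez0_abs.
by move=> h; exfalso; lia.
Qed.

(** Pigeonhole: among more powers of [x] than cosets, two lie in the same coset. *)
Lemma finite_index_pow (G : groupType) (A : G -> Prop) (x : G) :
  is_subgroup A -> finite_index A -> exists n : nat, (0 < n)%N /\ A (x ^+ n).
Proof.
case=> A1 AM AV [s cov].
have /boolp.choice[c cP] (i : 'I_(size s).+1) :
    exists k : 'I_(size s), A ((nth 1 s k)^-1 * x ^+ i).
  have [y ys Ay] := cov (x ^+ i).
  by rewrite -index_mem in ys; exists (Ordinal ys); rewrite /= nth_index // -index_mem.
have /injectivePn[i [j ij cij]] : ~~ injectiveb c.
  by apply/negP => /injectiveP /leq_card; rewrite !card_ord ltnn.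
wlog lt_ij : i j ij cij / (i < j)%N.
  move=> wl; case: (ltngtP i j) => [|ji|/val_inj eij]; first exact: wl.
    by apply: (wl j i) => //; rewrite eq_sym.
  by rewrite eij eqxx in ij.
exists (j - i)%N; rewrite subn_gt0 lt_ij; split=> //.
have -> : x ^+ (j - i) = (x ^+ i)^-1 * x ^+ j.
  by rewrite -{2}(subnKC (ltnW lt_ij)) expgnDr mulKg.
have := AM _ _ (AV _ (cP i)) (cP j); rewrite cij invgM invgK -mulgA.
by rewrite mulVKg.
Qed.

Lemma independent_le1 (A : groupType) (y : A) (b : nat) (x : 'I_b -> A) :
  (forall u : A, exists k i : int, k != 0%R /\ expgz u k = expgz y i) ->
  independent x -> (b <= 1)%N.
Proof.
move=> rel ind; rewrite leqNgt; apply/negP => b_gt1.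
case: b b_gt1 x ind => [|[|b]] // _ x ind.
have prod2 (k l : int) :
    let c (i : 'I_b.+2) := if i == ord0 then k else if i == lift ord0 ord0 then l else 0%R in
    \prod_(i < b.+2) expgz (x i) (c i) = expgz (x ord0) k * expgz (x (lift ord0 ord0)) l.
  rewrite /= big_ord_recl eqxx; congr (_ * _); rewrite big_ord_recl /=.
  by rewrite big1 ?mulg1 // => i _; rewrite -(inj_eq val_inj) -(inj_eq val_inj).
have ind2 (k l : int) : expgz (x ord0) k * expgz (x (lift ord0 ord0)) l = 1 ->
    k = 0%R /\ l = 0%R.
  by rewrite -prod2 => /ind h; have := h ord0; have := h (lift ord0 ord0).
have [k [i [k0 e0]]] := rel (x ord0); have [l [j [l0 e1]]] := rel (x (lift ord0 ord0)).
(* Both powers equal [expgz y (i * j)] up to inversion. Independence forces j = 0, so the second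
   element would be torsion. *)
have [] := ind2 (k * j)%R (- (l * i))%R.
  by rewrite expgzN !expgzM e0 e1 -!expgzM mulrC mulgV.
move/eqP; rewrite mulf_eq0 (negPf k0) => /= /eqP j0 _.
have [] := ind2 0%R l; first by rewrite mul1g e1 j0.
by move=> _ /eqP; rewrite (negPf l0).
Qed.

(** Composing one embedding with the inverse of the other gives surjections in both directions. *)
Lemma same_range_rank (G : groupType) m n
    (i : free_group_of_rank m -> G) (j : free_group_of_rank n -> G) :
  is_hom i -> is_hom j -> injective i -> injective j ->
  (forall g, (exists u, i u = g) <-> exists u, j u = g) -> m = n.
Proof.
move=> iM jM i_inj j_inj ij.
suff le p q (f : free_group_of_rank p -> G) (h : free_group_of_rank q -> G) :
    is_hom f -> is_hom h -> injective h ->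
    (forall g, (exists u, f u = g) <-> exists u, h u = g) -> (q <= p)%N.
  apply/eqP; rewrite eqn_leq (le _ _ j i) ?(le _ _ i j) // => g.
  by have := ij g; tauto.
move=> fM hM h_inj fh.
have /boolp.choice[c cE] u : exists v, h v = f u by apply/fh; exists u.
apply: (@free_rank_le _ _ c) => [u v|v].
  by apply: h_inj; rewrite hM !cE fM.
have /fh[u fu] : exists u, h u = h v by exists v.
by exists u; apply: h_inj; rewrite cE.
Qed.

Lemma free0_trivial (u : free_group_of_rank 0) : u = 1.
Proof.
apply: (free_group_ind (P := fun u => u = 1)) => [|[]//].
by split=> // [x y -> ->|x ->]; rewrite ?mulg1 ?invg1.
Qed.

(* For n >= 2 a central element of the fiber is central in F_n.  For n = 1 the
   fiber is infinite cyclic, and a nontrivial central element in it forces the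
   conjugation action on it to be trivial, so that G is abelian. *)
Lemma fiber_center (G : groupType) n (i : free_group_of_rank n -> G)
    (phi : G -> infinite_cyclic_group) (z : G) :
  is_hom i -> injective i -> is_hom phi -> surjective phi ->
  (forall g, (exists u, i u = g) <-> phi g = 1) ->
  ~ (forall x, center G x) -> center G z -> phi z = 1 -> z = 1.
Proof.
move=> iM i_inj phiM phi_surj ker nab Zz /ker[u iu].
case: n i iM i_inj ker u iu => [|[|n]] i iM i_inj ker u iu.
- by rewrite -iu (free0_trivial u) is_hom1.
- apply: contrapT => z1; apply: nab.
  have [k uk] := free1_gen u; set c := i (free_gen ord0).
  have zk : z = expgz c k by rewrite -iu uk is_hom_expgz.
  have c_tf l : expgz c l = 1 -> l = 0%R.
    move=> cl; apply/eqP/negP => /negP l0; apply: z1.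
    have g1 : (free_gen ord0 : free_group_of_rank 1) = 1.
      apply: (@free_torsion_free 1 _ _ l0); apply: i_inj.
      by rewrite (is_hom_expgz iM) (is_hom1 iM).
    by rewrite zk /c g1 is_hom1 // expg1z.
  have kerc g : phi g = 1 -> exists l, g = expgz c l.
    move/ker => [w <-]; have [l ->] := free1_gen w.
    by exists l; rewrite is_hom_expgz.
  have c1 : phi c = 1 by apply/ker; exists (free_gen ord0).
  have k0 : k != 0%R by apply/eqP => k0; apply: z1; rewrite zk k0.
  have Zc g : g * c = c * g.
    have [l cl] : exists l, g * c * g^-1 = expgz c l.
      by apply: kerc; rewrite !phiM c1 mulg1 -phiM mulgV is_hom1.
    have gc : g * c = expgz c l * g by rewrite -cl mulgVK.
    (* As [z = expgz c k] is central, c^(l k) = c^k; since [c] has infinite order, l = 1. *)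
    have := conj_expgz k gc; rewrite -zk -(Zz g) -expgzM zk => /(@mulIg G) /eqP.
    rewrite -divg_eq1 -expgzN -expgzD => /eqP /c_tf e.
    have l1 : l = 1%R.
      apply/eqP; rewrite -subr_eq0 -(inj_eq (mulIf k0)) mul0r mulrBl mul1r.
      by rewrite subr_eq0 eq_sym -subr_eq0 e.
    by rewrite gc l1.
  have [t t1] := phi_surj (1%R : int).
  have form g : exists p l, g = expgz t p * expgz c l.
    pose p : int := phi g.
    have [l cl] : exists l, expgz t (- p)%R * g = expgz c l.
      apply: kerc; rewrite phiM is_hom_expgz // t1 cyclic_expgzE mul1r.
      by rewrite cyclic_mulE addNr.
    by exists p, l; rewrite -cl expgzN mulVKg.
  move=> x y; have [p [l ->]] := form x; have [q [m ->]] := form y.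
  have Zcm m' g : commute g (expgz c m') by apply/commute_expgz/Zc.
  apply/commuteM; apply/commute_sym/commuteM; try exact: Zcm.
  + exact: expgzC.
  + exact/commute_sym/Zcm.
- rewrite -iu (_ : u = 1) ?is_hom1 //.
  apply: (@commensurated_free _ ord0 ord_max) => // g; exists 1%R, 1%R; split=> //.
  by apply: i_inj; rewrite !expgz1 !iM iu (Zz (i g)).
Qed.

(** * Weights and the modular homomorphism *)

Section GBSTheory.
Variables (V E : finType) (s t : E -> V) (T : {set E}) (lam mu : E -> int) (v0 : V).
Variables (G : groupType) (a : V -> G) (tau : E -> G).
Hypothesis pres : gbs_presentation s t T lam mu v0 a tau.

Let relE e : tau e * expgz (a (t e)) (mu e) = expgz (a (s e)) (lam e) * tau e.
Proof. by have [h _] := gbs_rel pres. Qed.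
Let relT e : e \in T -> tau e = 1.
Proof. by have [_ h] := gbs_rel pres; apply: h. Qed.
Let lam0 e : lam e != 0%R. Proof. exact: (gbs_lam pres). Qed.
Let mu0 e : mu e != 0%R. Proof. exact: (gbs_mu pres). Qed.
Let treeE e : e \in T -> expgz (a (t e)) (mu e) = expgz (a (s e)) (lam e).
Proof. by move=> eT; have := relE e; rewrite relT // mul1g mulg1. Qed.

(** Rational weights come from a gauge along the tree with ratios mu / lam; the product of all
    denominators then makes them integral. *)
Lemma tree_weights : exists d : V -> int, (forall v, d v != 0%R) /\
  forall e, e \in T -> (lam e * d (s e) = mu e * d (t e))%R.
Proof.
have lamQ e : ((lam e)%:~R != 0 :> rat)%R by rewrite intr_eq0.
have muQ e : ((mu e)%:~R != 0 :> rat)%R by rewrite intr_eq0.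
have [d [d0 dT]] := gbs_gauges pres
  (f := fun e (x : rat) => ((mu e)%:~R / (lam e)%:~R * x)%R)
  (f' := fun e (x : rat) => (((mu e)%:~R / (lam e)%:~R)^-1 * x)%R) 1%R
  (fun e => mulVKf (mulf_neq0 (muQ e) (invr_neq0 (lamQ e)))).
have d_neq0 v : d v != 0%R.
  move: v; apply: (gbs_tree pres); rewrite ?d0 // => e /dT ->.
  by rewrite !mulf_eq0 invr_eq0 (negPf (muQ e)) (negPf (lamQ e)).
pose D : int := (\prod_v denq (d v))%R.
pose dz v : int := (numq (d v) * \prod_(w | w != v) denq (d w))%R.
have D0 : (D%:~R != 0 :> rat)%R.
  by rewrite intr_eq0; apply/prodf_neq0 => v _; apply: denq_neq0.
have dzE v : ((dz v)%:~R = d v * D%:~R :> rat)%R.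
  by rewrite /dz /D [in RHS](bigD1 v) //= !intrM numqE mulrA.
exists dz; split=> [v|e eT].
  by rewrite -(intr_eq0 rat) dzE mulf_neq0.
apply: (@intr_inj rat); rewrite (intrM _ (lam e)) (intrM _ (mu e)) !dzE dT // !mulrA.
by rewrite (mulrC (lam e)%:~R%R) mulfK.
Qed.

Section Weights.
Variable d : V -> int.
Hypothesis d_neq0 : forall v, d v != 0%R.
Hypothesis d_tree : forall e, e \in T -> (lam e * d (s e) = mu e * d (t e))%R.

(** Common powers are propagated along the tree; the last conjunct records that the exponents match
    the weights. *)
Lemma vertex_commensurable v : exists X Y : int,
  [/\ X != 0%R, Y != 0%R, expgz (a v0) X = expgz (a v) Y & (X * d v0 = Y * d v)%R].
Proof.
move: v; apply: (gbs_tree pres); first by exists 1%R, 1%R.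
move=> e eT; split=> -[X [Y [X0 Y0 e1 e2]]].
  exists (X * lam e)%R, (Y * mu e)%R; split; rewrite ?mulf_neq0 ?lam0 ?mu0 //.
    by rewrite expgzM e1 -expgzM mulrC (mulrC Y) !expgzM treeE.
  by rewrite mulrAC e2 mulrAC -mulrA d_tree // mulrA.
exists (X * mu e)%R, (Y * lam e)%R; split; rewrite ?mulf_neq0 ?lam0 ?mu0 //.
  by rewrite expgzM e1 -expgzM mulrC (mulrC Y) !expgzM treeE.
by rewrite mulrAC e2 mulrAC -mulrA -d_tree // mulrA.
Qed.

(** The elements satisfying the condition form a subgroup; each [a v] shares a power with [a v0],
    and [tau e] carries a power of [a (t e)] to one of [a (s e)]. *)
Lemma vertex_commensurated : commensurated (a v0).
Proof.
apply: (gbs_gen pres).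
- split=> [|g h [p [q [p0 q0 eg]]] [p' [q' [p0' q0' eh]]]|g [p [q [p0 q0 eg]]]].
  + by exists 1%R, 1%R; split=> //; rewrite mul1g mulg1.
  + exists (p * p')%R, (q' * q)%R; rewrite !mulf_neq0 //; split=> //.
    rewrite (expgzM _ q') -mulgA (conj_expgz q eh) -expgzM (mulrC p') (expgzM _ q).
    by rewrite mulgA (conj_expgz p' eg) -expgzM mulgA.
  + exists q, p; split=> //; apply: (mulgI g); rewrite mulVKg mulgA eg mulgK //.
- move=> v; have [X [Y [X0 Y0 e1 _]]] := vertex_commensurable v.
  exists X, X; split=> //; rewrite e1; exact: commute_expgz.
- move=> e; have [X [Y [X0 Y0 es _]]] := vertex_commensurable (s e).
  have [X' [Y' [X0' Y0' et _]]] := vertex_commensurable (t e).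
  exists (X * (lam e * Y'))%R, (X' * (mu e * Y))%R; rewrite !mulf_neq0 //; split=> //.
  rewrite !(expgzM (a v0)) es et -!expgzM.
  rewrite (_ : Y' * (mu e * Y) = mu e * (Y * Y'))%R; last by lia.
  rewrite (_ : Y * (lam e * Y') = lam e * (Y * Y'))%R; last by lia.
  by rewrite !(expgzM _ _ (Y * Y')%R); apply: conj_expgz.
Qed.

(* In the affine representation a_v |-> x + d_v, t_e |-> Delta_e x, a nontrivial central
   translation forces Delta_e = 1. *)
Lemma weights_consistent_of_central k e : k != 0%R -> center G (expgz (a v0) k) ->
  (lam e * d (s e) = mu e * d (t e))%R.
Proof.
move=> k0 Zk; apply/eqP/negP => /negP bad.
have D0 f : ((lam f * d (s f))%:~R / (mu f * d (t f))%:~R != 0 :> rat)%R.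
  by rewrite mulf_neq0 ?invr_eq0 ?intr_eq0 ?mulf_neq0.
pose a' v : affine := aff (oner_neq0 _) (d v)%:~R%R.
pose tau' f : affine := aff (D0 f) 0%R.
have [|f [fM fa ft]] := @gbs_univ _ _ _ _ _ _ _ _ _ _ _ pres affine a' tau'.
  split=> [f|f fT].
    rewrite !aff_translationX; apply: affP; rewrite /= ?mulr1 ?mul1r // addr0 add0r.
    by rewrite (mulrC (d (t f))%:~R%R) -!intrM mulfVK ?intr_eq0 ?mulf_neq0 // mulrC.
  by apply: affP => //=; rewrite d_tree // mulfV // intr_eq0 mulf_neq0.
have := congr1 f (Zk (tau e)); rewrite !fM (is_hom_expgz fM) fa ft aff_translationX.
move/(congr1 (fun x : affine => (val x).2)); rewrite /= mulr0 add0r addr0.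
rewrite -{1}[(_ * _)%R]mul1r => /mulIf.
have z0 : ((d v0)%:~R * k%:~R != 0 :> rat)%R by rewrite mulf_neq0 ?intr_eq0.
move=> /(_ z0) e1; move/negP: bad; apply; apply/eqP/(@intr_inj rat).
have m0 : ((mu e * d (t e))%:~R != 0 :> rat)%R by rewrite intr_eq0 mulf_neq0.
by rewrite -[LHS](mulfVK m0) -e1 mul1r.
Qed.

End Weights.
End GBSTheory.

(** * Abelianization, central quotient and consistency of the weights *)

Section CenterQuotient.
Variables (V E : finType) (s t : E -> V) (T : {set E}) (lam mu : E -> int) (v0 : V).
Variables (G : groupType) (a : V -> G) (tau : E -> G).
Hypothesis pres : gbs_presentation s t T lam mu v0 a tau.

Local Notation pi := (to_quotient (center G)).
Local Notation piM := (to_quotient_hom (center G)).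
Local Notation ab := (to_quotient (derived_subgroup G)).
Local Notation abM := (to_quotient_hom (derived_subgroup G)).

Lemma abelianization_comm (x y : abelianization G) : x * y = y * x.
Proof.
have [g <-] := to_quotient_surj x; have [h <-] := to_quotient_surj y.
rewrite -!abM; apply/to_quotientP/normal_closure_sub.
by exists h, g; rewrite commgEl conjgE invgM !mulgA.
Qed.

(** The elements of which a nonzero power is a power of [y] in the abelianization form a subgroup,
    so generators suffice. *)
Lemma gbs_betti_le1 (y : G) b (x : 'I_b -> abelianization G) :
  (forall v, exists k i : int, k != 0%R /\ expgz (ab (a v)) k = expgz (ab y) i) ->
  (forall e, exists k i : int, k != 0%R /\ expgz (ab (tau e)) k = expgz (ab y) i) ->
  independent x -> (b <= 1)%N.
Proof.
move=> ya yt; apply: (independent_le1 (y := ab y)) => u.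
have [g <-] := to_quotient_surj u; move: g.
apply: (gbs_gen pres) => //; split.
- by exists 1%R, 0%R; rewrite is_hom1 //; apply: abM.
- move=> g h [k [i [k0 e1]]] [l [j [l0 e2]]].
  exists (k * l)%R, (i * l + j * k)%R; split; first by rewrite mulf_neq0.
  rewrite abM expgzMn; last exact: abelianization_comm.
  by rewrite expgzM e1 (mulrC k) expgzM e2 expgzD !expgzM.
- move=> g [k [i [k0 e1]]]; exists k, (- i)%R; split=> //.
  rewrite expgzN -e1 (is_homV abM) -expgzN -[in RHS]mulN1r expgzM expgzN expgz1 //.
Qed.

Lemma finite_index_range_pow (H : groupType) (j : H -> quotient_group (center G)) g :
  is_hom j -> finite_index (range j) -> exists n : nat, (0 < n)%N /\
    exists u, j u = pi (g ^+ n).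
Proof.
move=> jM fi; have jsub : is_subgroup (range j).
  split; first by exists 1; rewrite ?is_hom1.
    by move=> _ _ [u _ <-] [v _ <-]; exists (u * v); rewrite ?jM.
  by move=> _ [u _ <-]; exists u^-1; rewrite ?is_homV.
have [n [n0 [u _ ju]]] := finite_index_pow (pi g) jsub fi.
by exists n; split=> //; exists u; rewrite ju -[LHS]/(expgz (pi g) (Posz n)) -(is_hom_expgz piM).
Qed.

(* If the modular homomorphism is nontrivial, the vertex generators are torsion in
   the abelianization, so two edges e1, e2 lie outside the tree.  Sending their
   stable letters to x -> 2x and x -> x + 1 shows that no powers of them commute;
   but if G/Z(G) is virtually cyclic, then G is virtually abelian. *)
Lemma two_stable_letters_absurd (e1 e2 : E)
    (j : free_group_of_rank 1 -> quotient_group (center G)) :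
  is_hom j -> finite_index (range j) -> e1 \notin T -> e2 \notin T -> e1 != e2 -> False.
Proof.
move=> jM fi e1T e2T e12.
have two0 : (2%:R != 0 :> rat)%R by [].
pose h1 : affine := aff two0 0%R; pose h2 : affine := aff (oner_neq0 _) 1%R.
have [|f [fM fa ft]] := gbs_univ pres (X := affine) (a' := fun=> 1)
    (tau' := fun e => if e == e1 then h1 else if e == e2 then h2 else 1).
  split=> [e|e eT]; first by rewrite !expg1z mulg1 mul1g.
  by rewrite !ifN //; [apply: contraNneq e2T|apply: contraNneq e1T] => <-.
have [m [m0 [u1 ju1]]] := finite_index_range_pow (tau e1) jM fi.
have [n [n0 [u2 ju2]]] := finite_index_range_pow (tau e2) jM fi.
have [c pic] := to_quotient_surj (j (free_gen ord0)).
have form g u : j u = pi g -> exists k z, g = expgz c k * z /\ center G z.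
  have [k ->] := free1_gen u; rewrite (is_hom_expgz jM) -pic -(is_hom_expgz piM).
  move/to_quotientP => Zz; exists k, ((expgz c k)^-1 * g); split=> //.
  by rewrite mulVKg.
have [k1 [z1 [E1 Z1]]] := form _ _ ju1; have [k2 [z2 [E2 Z2]]] := form _ _ ju2.
have cm : commute (tau e1 ^+ m) (tau e2 ^+ n).
  rewrite E1 E2; apply/commuteM; last exact/commute_sym/Z2.
  by apply/commute_sym/commuteM; [exact: expgzC|exact/commute_sym/Z1].
have := congr1 f cm; rewrite !fM.
rewrite -[_ ^+ m]/(expgz _ (Posz m)) -[_ ^+ n]/(expgz _ (Posz n)) !(is_hom_expgz fM) !ft.
rewrite eqxx eq_sym (negPf e12) eqxx aff_translationX.
have [x1 x2] := aff_homothetyX two0 m.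
(* Comparing translation parts gives 2^m n = n with m and n positive. *)
move/(congr1 (fun x : affine => (val x).2)); rewrite /= x1 x2 addr0 mulr0 add0r !mul1r.
move=> /eqP; rewrite -subr_eq0 -[X in (_ - X)%R]mul1r -mulrBl mulf_eq0 intr_eq0.
rewrite subr_eq0 eqz_nat (gtn_eqF n0) orbF => /eqP p2.
have := expr_gt1 (n := m) (x := 2%:R : rat); rewrite p2 ltxx => /(_ _ _) h.
by have := h m0 isT; rewrite ltr1n.
Qed.

(** A power of [a v0] lands in the free subgroup as a commensurated element. In rank at least 2 it
    is trivial there, so that power is central; in rank 1 an inconsistent edge contradicts the Betti
    number or yields two stable letters. *)
Lemma weights_consistent (d : V -> int) r b (x : 'I_b -> abelianization G) :
  (forall v, d v != 0%R) ->
  (forall e, e \in T -> (lam e * d (s e) = mu e * d (t e))%R) ->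
  has_free_finite_index_subgroup (quotient_group (center G)) r.+1 ->
  independent x -> (1 < b)%N ->
  forall e, (lam e * d (s e) = mu e * d (t e))%R.
Proof.
move=> d0 dT [j [j_inj fi]] x_ind b_gt1 e; have jM := ghom_is_hom j.
have [|e_bad] := eqVneq (lam e * d (s e))%R (mu e * d (t e))%R; first by [].
have [k [k0 [f jf]]] := finite_index_range_pow (a v0) jM fi.
have fC : commensurated f.
  move=> g; have [h ph] := to_quotient_surj (j g).
  have [p [q [p0 q0 eh]]] := vertex_commensurated pres dT h.
  exists p, q; split=> //; apply: j_inj; rewrite !jM !(is_hom_expgz jM) jf -ph.
  rewrite -[_ ^+ k]/(expgz _ (Posz k)) -!(is_hom_expgz piM) -!piM -!expgzM.
  rewrite !(mulrC (Posz k)) !expgzM.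
  by rewrite (conj_expgz (Posz k) eh).
case: r j j_inj fi jM f jf fC => [|r] j j_inj fi jM f jf fC; last first.
  have f1 : f = 1 by apply: (@commensurated_free _ ord0 ord_max).
  apply: (weights_consistent_of_central pres d0 dT (k := Posz k)) => //.
    by rewrite eqz_nat -lt0n.
  by apply/(to_quotient_eq1 (center G)); rewrite -[expgz _ _]/(a v0 ^+ k) -jf f1 is_hom1.
have tor v : exists l : int, l != 0%R /\ expgz (ab (a v)) l = 1.
  have com w := vertex_commensurable pres dT w.
  suff [l [l0 al]] : exists l : int, l != 0%R /\ expgz (ab (a v0)) l = 1.
    have [X [Y [X0 Y0 e1 _]]] := com v; exists (Y * l)%R; rewrite mulf_neq0 //; split=> //.
    by rewrite expgzM -(is_hom_expgz abM) -e1 (is_hom_expgz abM) -expgzM mulrC expgzM al expg1z.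
  have [X [Y [X0 Y0 e1 w1]]] := com (s e); have [X' [Y' [X0' Y0' e2 w2]]] := com (t e).
  have st : expgz (ab (a (t e))) (mu e) = expgz (ab (a (s e))) (lam e).
    have [rel _] := gbs_rel pres; have := congr1 ab (rel e).
    rewrite !abM !(is_hom_expgz abM) abelianization_comm; exact: mulIg.
  (* Up to sign, this exponent times [d v0] is the defect of the weights at [e] times [Y * Y'],
     hence it is nonzero. *)
  exists (X' * mu e * Y - X * lam e * Y')%R; split.
    apply: contra_neq e_bad => z; apply/eqP.
    have d00 := d0 v0.
    suff : ((lam e * d (s e) - mu e * d (t e)) * (Y * Y') == 0)%R.
      by rewrite !mulf_eq0 (negPf Y0) (negPf Y0') !orbF subr_eq0.
    rewrite mulrBl; apply/eqP.
    have -> : (lam e * d (s e) * (Y * Y') = (X * d v0) * lam e * Y')%R by rewrite w1; ring.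
    have -> : (mu e * d (t e) * (Y * Y') = (X' * d v0) * mu e * Y)%R by rewrite w2; ring.
    by rewrite -[RHS](mulr0 (- d v0)%R) -z; ring.
  have A1 : expgz (ab (a v0)) X = expgz (ab (a (s e))) Y by rewrite -!(is_hom_expgz abM) e1.
  have A2 : expgz (ab (a v0)) X' = expgz (ab (a (t e))) Y' by rewrite -!(is_hom_expgz abM) e2.
  rewrite expgzD expgzN -!mulrA !expgzM A1 A2 -!expgzM.
  have -> : (Y' * (mu e * Y) = mu e * (Y * Y'))%R by ring.
  have -> : (Y * (lam e * Y') = lam e * (Y * Y'))%R by ring.
  by rewrite !(expgzM _ _ (Y * Y')%R) st mulgV.
have eT : e \notin T by apply: contra e_bad => /dT ->.
(* If [e] is the only edge outside the tree, the abelianization is generated by [tau e] up to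
   torsion. *)
have [/forallP onlye|] := boolP [forall e', (e' != e) ==> (e' \in T)].
  exfalso; have : (b <= 1)%N.
    apply: (gbs_betti_le1 (y := tau e)) x_ind => [v|e'].
      by have [l [l0 al]] := tor v; exists l, 0%R.
    exists 1%R; have [->|ne] := eqVneq e' e; first by exists 1%R.
    exists 0%R; split=> //; have [_ relT] := gbs_rel pres.
    by rewrite relT ?(is_hom1 abM) //; apply: (implyP (onlye e')).
  by rewrite leqNgt b_gt1.
rewrite negb_forall => /existsP[e']; rewrite negb_imply => /andP[ne e'T].
by exfalso; apply: (@two_stable_letters_absurd e' e j).
Qed.

End CenterQuotient.

(** * Heights, the center and ranks of fibers *)

Section Fibers.
Variables (V E : finType) (s t : E -> V) (T : {set E}) (lam mu : E -> int) (v0 : V).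
Variables (G : groupType) (a : V -> G) (tau : E -> G).
Hypothesis pres : gbs_presentation s t T lam mu v0 a tau.

(** The weights define a homomorphism to the integers; dividing by the generator of its image makes
    it onto. *)
Lemma normalized_height (d : V -> int) : (forall v, d v != 0%R) ->
  (forall e, (lam e * d (s e) = mu e * d (t e))%R) ->
  exists phi : G -> infinite_cyclic_group,
    [/\ is_hom phi, surjective phi, forall v, (phi (a v) : int) != 0%R
      & forall e, phi (tau e) = 1].
Proof.
move=> d0 dE.
have [|f [fM fa ft]] := gbs_univ pres (X := infinite_cyclic_group)
    (a' := fun v => d v : infinite_cyclic_group) (tau' := fun=> 1).
  by split=> // e; rewrite mul1g mulg1 !cyclic_expgzE mulrC -dE mulrC.
have [|u v [g <-] [h <-]|||N [N0 [g1 fg1] Nf]] :=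
    @int_subgroup (fun k => exists g, (f g : int) = k) (d v0).
- by exists 1; rewrite is_hom1.
- by exists (g * h^-1); rewrite fM is_homV // cyclic_mulE cyclic_invE.
- by exists (a v0); rewrite fa.
- exact: d0.
have N0' : (Posz N != 0)%R by rewrite eqz_nat -lt0n.
have /boolp.choice[phi phiE] g : exists k : int, (f g : int) = (k * Posz N)%R.
  by apply: Nf; exists g.
have phiM : is_hom (phi : G -> infinite_cyclic_group).
  by move=> g h; apply: (mulIf N0'); rewrite cyclic_mulE mulrDl -!phiE fM.
exists phi; split=> //.
- move=> k; exists (expgz g1 (k : int)); apply: (mulIf N0').
  by rewrite -phiE is_hom_expgz // cyclic_expgzE fg1 mulrC.
- move=> v; apply: contra_neq (d0 v) => p0; rewrite -(fa v).
  by rewrite phiE p0 mul0r.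
- by move=> e; apply: (mulIf N0'); rewrite -phiE ft mul0r.
Qed.

Variable phi : G -> infinite_cyclic_group.
Hypotheses (phiM : is_hom phi) (phi_surj : surjective phi).
Hypotheses (phi_a : forall v, (phi (a v) : int) != 0%R) (phi_tau : forall e, phi (tau e) = 1).

Let h v : int := phi (a v).

Lemma height_rel e : (lam e * h (s e) = mu e * h (t e))%R.
Proof.
have [rel _] := gbs_rel pres; have := congr1 phi (rel e).
rewrite !phiM !(is_hom_expgz phiM) phi_tau mul1g mulg1 !cyclic_expgzE /h => e1.
by rewrite mulrC -e1 mulrC.
Qed.

(** Comparing heights in g a^q = a^p g gives p = q, so each generator commutes with a power of
    [a v0]; the product of the exponents serves all generators. *)
Lemma central_power : exists k : int, k != 0%R /\ center G (expgz (a v0) k).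
Proof.
have tree e : e \in T -> (lam e * h (s e) = mu e * h (t e))%R by move=> _; apply: height_rel.
have com g : exists q : int, q != 0%R /\ commute g (expgz (a v0) q).
  have [p [q [p0 q0 e]]] := vertex_commensurated pres tree g.
  exists q; split=> //; rewrite /commute e; congr (expgz _ _ * _).
  apply: (mulfI (phi_a v0)); have := congr1 phi e.
  rewrite !phiM !(is_hom_expgz phiM) !cyclic_mulE !cyclic_expgzE addrC.
  by move/addIr.
have /boolp.choice[qv qvP] v := com (a v); have /boolp.choice[qe qeP] e := com (tau e).
pose k := (\prod_v qv v * \prod_e qe e)%R.
exists k; split.
  rewrite mulf_neq0 //; apply/prodf_neq0 => x _.
    by case: (qvP x).
  by case: (qeP x).
move=> x; apply: commute_sym; move: x; apply: (gbs_gen pres).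
- split=> [|x y cx cy|x cx]; first exact/commute_sym/commute1.
    by apply/commute_sym/commuteM; apply/commute_sym.
  by apply/commute_sym/commuteV/commute_sym.
- move=> v; rewrite /k (bigD1 v) //= -mulrA expgzM; apply: commute_expgz.
  by case: (qvP v).
- move=> e; rewrite /k (bigD1 e) //= mulrCA expgzM; apply: commute_expgz.
  by case: (qeP e).
Qed.

(** The kernel of [phi] is the stabilizer of 0 under translations. *)
Lemma height_fiber : exists r (i : free_group_of_rank r -> G),
  [/\ (r + \sum_v `|h v| = \sum_e `|lam e| * `|h (s e)| + 1)%N, is_hom i, injective i &
      forall g, (exists u, i u = g) <-> phi g = 1].
Proof.
have tr w : exists g, translation phiM g 0%R = w.
  by have [g gw] := phi_surj w; exists g; rewrite /= gw addr0.
have fo v : free_orbits (zact (translation phiM) (a v)) `|h v|%N.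
  exact: translation_free_orbits.
have [r [i [er iM i_inj i_stab]]] := stabilizer_free pres tr fo.
exists r, i; split=> // g; rewrite i_stab /= addr0; tauto.
Qed.

Hypothesis nonabelian : ~ (forall x, center G x).

Lemma height_center z : center G z -> phi z = 1 -> z = 1.
Proof.
have [r [i [_ iM i_inj i_ker]]] := height_fiber.
exact: (@fiber_center G r i phi).
Qed.

(** [phi] is injective on the center, so a central element of least positive height generates it.
    The quotient of a_v^N by z^(h v) has height 0 and a trivial power, and the fiber is torsion
    free. *)
Lemma center_generator : exists (z : G) (N : nat),
  [/\ (0 < N)%N, center G z, phi z = Posz N,
      forall x, center G x -> exists k, x = expgz z k
    & forall v, expgz (a v) (Posz N) = expgz z (h v)].
Proof.
have [k [k0 Zk]] := central_power.
have ZX x l : center G x -> center G (expgz x l) by apply: center_expgz.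
have [|u v [x Zx <-] [y Zy <-]|||N [N0 [z Zz zN] NZ]] :=
    @int_subgroup (fun m => exists2 x, center G x & (phi x : int) = m) (h v0 * k)%R.
- by exists 1; [exact: nsub1|rewrite is_hom1].
- exists (x * y^-1); last by rewrite phiM is_homV // cyclic_mulE cyclic_invE.
  by apply: nsubM => //; apply: nsubV.
- by exists (expgz (a v0) k) => //; rewrite is_hom_expgz // cyclic_expgzE.
- by rewrite mulf_neq0 ?phi_a.
exists z, N; split=> //.
- move=> x Zx; have [|l xl] := NZ (phi x : int); first by exists x.
  exists l; apply: (mulIg (expgz z l)^-1); rewrite mulgV; apply: height_center.
    by apply: nsubM => //; apply: nsubV; apply: ZX.
  rewrite phiM is_homV // is_hom_expgz // cyclic_expgzE cyclic_mulE cyclic_invE zN xl.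
  by rewrite mulrC subrr.
- move=> v; pose u := expgz (a v) (Posz N) * (expgz z (h v))^-1.
  suff u1 : u = 1 by apply: (mulIg (expgz z (h v))^-1); rewrite mulgV.
  have phiu : phi u = 1.
    rewrite /u phiM (is_homV phiM) !(is_hom_expgz phiM) !cyclic_expgzE zN.
    by rewrite cyclic_mulE cyclic_invE mulrC subrr.
  have [r [i [_ iM i_inj i_ker]]] := height_fiber.
  have [w iw] : exists w, i w = u by apply/i_ker.
  have tree e : e \in T -> (lam e * h (s e) = mu e * h (t e))%R by move=> _; apply: height_rel.
  have [X [Y [X0 Y0 e1 _]]] := vertex_commensurable pres tree v.
  have Yk0 : (Y * k != 0)%R by rewrite mulf_neq0.
  have Zak : center G (expgz (a v) (Y * k)%R).
    by rewrite expgzM -e1 -expgzM mulrC expgzM; apply: ZX.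
  have cuz : commute (expgz (a v) (Posz N)) (expgz z (h v))^-1.
    have Zzh : center G (expgz z (h v))^-1 by apply: nsubV; apply: ZX.
    exact/commute_sym/Zzh.
  have uk : expgz u (Y * k)%R = 1.
    apply: height_center; last by rewrite is_hom_expgz // phiu expg1z.
    rewrite /u expgzMn // -expgzM (mulrC (Posz N)) (expgzM (a v)).
    apply: nsubM; first exact: ZX Zak.
    by apply/ZX/nsubV/ZX.
  rewrite -iw (_ : w = 1) ?is_hom1 //; apply: (free_torsion_free Yk0); apply: i_inj.
  by rewrite is_hom_expgz // iw uk is_hom1.
Qed.

Variables (z : G) (N : nat).
Hypotheses (N_gt0 : (0 < N)%N) (z_center : center G z) (phi_z : phi z = Posz N).
Hypothesis a_z : forall v, expgz (a v) (Posz N) = expgz z (h v).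

(** From a_v^N = z^(h v), the number n of orbits of [a v] satisfies N n = |h v| I; once [N] divides
    [I], with quotient q, this reads n = q |h v|. *)
Theorem stabilizer_rank (Omega : Type) (act : left_action G Omega) (w0 : Omega) I :
  (forall w, exists g, act g w0 = w) -> free_orbits (zact act z) I ->
  exists q r (i : free_group_of_rank r -> G),
  [/\ I = (q * N)%N, (0 < q)%N,
      (r + q * \sum_v `|h v| = q * \sum_e `|lam e| * `|h (s e)| + 1)%N,
      is_hom i /\ injective i &
      forall g, (exists u, i u = g) <-> act g w0 = w0].
Proof.
move=> trans foz.
have I0 : (0 < I)%N by case: (foz) => D; case: I D {foz} => // D; case: (orb_cls D w0).
have N0 : Posz N != 0%R by rewrite eqz_nat -lt0n.
have fo v : exists n, free_orbits (zact act (a v)) n /\ (`|h v| * I = N * n)%N.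
  have foN := free_orbits_pow (phi_a v) foz; rewrite -/(h v) -a_z in foN.
  by have [n [fon e]] := free_orbits_root N0 foN; exists n.
have [g1 phi_g1] := phi_surj (1%R : int).
have N_dvd : (N %| I)%N.
  (* The divisibility is checked on generators and then applied to an element of height 1. *)
  suff dvd g : (Posz N %| ((phi g : int) * Posz I)%R)%Z.
    by have := dvd g1; rewrite phi_g1 mul1r.
  move: g; apply: (gbs_gen pres).
  - split=> [|x y Px Py|x Px].
    + by rewrite is_hom1 // mul0r dvdz0.
    + by rewrite phiM cyclic_mulE mulrDl rpredD.
    + by rewrite is_homV // cyclic_invE mulNr rpredN.
  - move=> v; have [n [_ e]] := fo v.
    by rewrite dvdzE abszM /= e dvdn_mulr.
  - by move=> e; rewrite phi_tau mul0r dvdz0.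
have /dvdnP[q Iq] := N_dvd; exists q.
have q0 : (0 < q)%N by move: I0; rewrite Iq; case: (q).
have fo' v : free_orbits (zact act (a v)) (q * `|h v|)%N.
  have [n [fon]] := fo v; rewrite Iq mulnA [RHS]mulnC => /eqP.
  by rewrite eqn_pmul2r // mulnC => /eqP ->.
have [r [i [er iM i_inj i_stab]]] := stabilizer_free pres trans fo'.
exists r, i; split=> //; rewrite !big_distrr /= er.
by congr addn; apply: eq_bigr => e _; rewrite mulnCA.
Qed.

Hypothesis z_gen : forall x, center G x -> exists k, x = expgz z k.

Local Notation pi := (to_quotient (center G)).
Local Notation piM := (to_quotient_hom (center G)).

Lemma z_torsion_free k : expgz z k = 1 -> k = 0%R.
Proof.
move/(congr1 phi); rewrite is_hom_expgz // is_hom1 // phi_z cyclic_expgzE => e.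
by have [e'|] := eqVneq k 0%R => //; move/eqP: e; rewrite mulf_eq0 => /orP[|/eqP //]; lia.
Qed.

(** The fiber meets the center trivially, hence embeds in the quotient; since [z] has height [N],
    the powers x^k with k < N represent all cosets. *)
Lemma height_fiber_finite_index r (i : free_group_of_rank r -> G) :
  is_hom i -> injective i -> (forall g, (exists u, i u = g) <-> phi g = 1) ->
  has_free_finite_index_subgroup (quotient_group (center G)) r.
Proof.
move=> iM i_inj i_ker.
have fM : is_hom (fun u => pi (i u)) by move=> u v; rewrite iM piM.
exists (ghom_of_hom fM); split.
  apply: (is_hom_inj fM) => u /(to_quotient_eq1 (center G)) Zu.
  apply: i_inj; rewrite is_hom1 //; apply: height_center => //.
  by apply/i_ker; exists u.
have [x x1] := phi_surj (1%R : int).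
exists [seq pi (x ^+ k) | k <- iota 0 N] => y.
have [g <-] := to_quotient_surj y.
pose m := ((phi g : int) %% Posz N)%Z; pose l := ((phi g : int) %/ Posz N)%Z.
have N0 : Posz N != 0%R by rewrite eqz_nat -lt0n.
have m0 : (0 <= m)%R by apply: modz_ge0.
have mN : (m < Posz N)%R by have := ltz_mod (phi g : int) N0; rewrite /m; lia.
exists (pi (x ^+ `|m|)).
  by apply: map_f; rewrite mem_iota add0n; lia.
have [u iu] : exists u, i u = expgz x (- m)%R * g * expgz z (- l)%R.
  apply/i_ker; rewrite !phiM !(is_hom_expgz phiM) x1 phi_z !cyclic_expgzE !cyclic_mulE.
  have -> : phi g = (l * Posz N + m)%R :> infinite_cyclic_group by exact: divz_eq.
  by rewrite -[RHS]/(0%R : int); ring.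
exists u => //=; rewrite iu !piM -!(is_homV piM).
have -> : x ^+ `|m| = expgz x m by rewrite -{2}(gez0_abs m0).
rewrite -expgzN -mulgA [X in _ * (_ * X)](_ : _ = 1) ?mulg1 //.
apply/(to_quotient_eq1 (center G)); exact: center_expgz.
Qed.

(** The free subgroup lifts to a subgroup of [G] meeting the center trivially. On its cosets [z]
    acts freely, with finitely many orbits by finite index, and the base stabilizer is the lift. *)
Lemma virtually_free_rank r : has_free_finite_index_subgroup (quotient_group (center G)) r ->
  exists q, (0 < q)%N /\
  (r + q * \sum_v `|h v| = q * \sum_e `|lam e| * `|h (s e)| + 1)%N.
Proof.
case=> j [j_inj [S cov]]; have jM := ghom_is_hom j.
have /boolp.choice[lift liftE] (x : 'I_r) : exists g, pi g = j (free_gen x).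
  exact: to_quotient_surj.
pose sigma : free_group_of_rank r -> G := free_lift lift.
have sigmaM : is_hom sigma by apply: free_lift_hom.
have pi_sigma u : pi (sigma u) = j u.
  move: u; apply: free_hom_ext => // [x y|x]; first by rewrite sigmaM piM.
  by rewrite /sigma free_lift_gen.
have sigma_inj : injective sigma.
  by move=> u v e; apply: j_inj; rewrite -!pi_sigma e.
pose Sg g := exists u, sigma u = g.
have Ssub : is_subgroup Sg.
  split; first by exists 1; rewrite is_hom1.
    by move=> _ _ [u <-] [v <-]; exists (u * v); rewrite sigmaM.
  by move=> _ [u <-]; exists u^-1; rewrite is_homV.
pose act := coset_action Ssub; pose w0 := left_coset Sg 1.
have trans w : exists g, act g w0 = w.
  by have [g <-] := left_coset_surj w; exists g; rewrite /act coset_actionE mulg1.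
have z_free k w : act (expgz z k) w = w -> k = 0%R.
  have [g <-] := left_coset_surj w; rewrite /act coset_actionE => /esym /(left_cosetP Ssub).
  have Zzk : center G (expgz z k) by apply: center_expgz.
  rewrite (Zzk g) mulKg => -[u su]; apply: z_torsion_free; rewrite -su.
  rewrite (_ : u = 1) ?is_hom1 //; apply: j_inj; rewrite is_hom1 // -pi_sigma su.
  exact/(to_quotient_eq1 (center G)).
have /boolp.choice[rep repE] (y : quotient_group (center G)) : exists g, pi g = y.
  exact: to_quotient_surj.
have z_cov w : exists k (i : 'I_(size S)),
    act (expgz z k) (left_coset Sg (rep (nth 1 S i))) = w.
  have [g <-] := left_coset_surj w.
  have [y yS [u _ ju]] := cov (pi g).
  have [k zk] : exists k, (rep y * sigma u)^-1 * g = expgz z k.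
    apply: z_gen; apply/to_quotientP; rewrite piM repE pi_sigma ju mulVKg //.
  have iy : (index y S < size S)%N by rewrite index_mem.
  exists k, (Ordinal iy); rewrite nth_index // /act coset_actionE.
  apply/(left_cosetP Ssub); exists u.
  have -> : g = rep y * sigma u * expgz z k by rewrite -zk mulVKg.
  have Zzk : center G (expgz z k) by apply: center_expgz.
  by rewrite -(Zzk (rep y * sigma u)) (mulgA (expgz z k)) mulKg.
have [I foI] := free_orbits_exist z_free z_cov.
have [q [r' [i [_ q0 er [iM i_inj] i_stab]]]] := stabilizer_rank trans foI.
exists q; split=> //; rewrite -er; congr (_ + _)%N.
apply: (same_range_rank sigmaM iM) => // g; rewrite i_stab -/(Sg g).
rewrite /act coset_actionE mulg1; split=> [Sgg|/esym /(left_cosetP Ssub)].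
  by apply/esym/(left_cosetP Ssub); rewrite invg1 mul1g.
by rewrite invg1 mul1g.
Qed.

End Fibers.

(** * Ranks of fibers as an arithmetic progression *)

Theorem corollary7p5 (G : groupType) (eps b : nat)
    (G_GBS : GBS_group G)
    (G_non_elementary : non_elementary G)
    (G_center : nontrivial_center G)
    (G_eps : associated_integer G eps)
    (G_betti : first_betti_number G b)
    (b_ge2 : (2 <= b)%N)
    (n : nat) :
  (exists (i : {ghom free_group_of_rank n -> G})
          (phi : {ghom G -> infinite_cyclic_group}),
     short_exact i phi)
  <->
  (exists p : nat, (1 <= p)%N /\ n = (p * eps + 1)%N).
Proof.
have [V [E [s [t [T [lam [mu [v0 [a [tau pres]]]]]]]]]] := GBS_has_presentation G_GBS.
have [[vfree vfree_min] [[x x_ind] _]] := (G_eps, G_betti).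
(* An abelian [G] would have trivial central quotient, with a free subgroup of rank 0 < eps + 1. *)
have nonabelian : ~ (forall g, center G g).
  move=> ab; suff /vfree_min : has_free_finite_index_subgroup (quotient_group (center G)) 0.
    by rewrite ltn0.
  have triv (u : quotient_group (center G)) : u = 1.
    by have [g <-] := to_quotient_surj u; apply/(to_quotient_eq1 (center G)).
  have cM : is_hom (fun _ : free_group_of_rank 0 => 1 : quotient_group (center G)).
    by move=> *; rewrite mulg1.
  exists (ghom_of_hom cM); split=> [u v _|]; first by rewrite (free0_trivial u) (free0_trivial v).
  exists [:: 1] => u; exists 1; rewrite ?inE //; exists 1 => //=.
have [d [d0 dT]] := tree_weights pres.
have dE := weights_consistent pres d0 dT vfree x_ind b_ge2.
have [phi [phiM phi_surj phi_a phi_tau]] := normalized_height pres d0 dE.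
have [z [N [N0 Zz phi_z z_gen a_z]]] :=
  center_generator pres phiM phi_surj phi_a phi_tau nonabelian.
have rank (Omega : Type) (act : left_action G Omega) w0 I :=
  @stabilizer_rank _ _ _ _ _ _ _ _ _ _ _ pres _ phiM phi_surj phi_a phi_tau _ _ N0 a_z
    Omega act w0 I.
set A := (\sum_v `|(phi (a v) : int)|)%N in rank.
set B := (\sum_e `|lam e| * `|(phi (a (s e)) : int)|)%N in rank.
(* The fiber of [phi] has rank B - A + 1, so minimality gives B - A >= eps; the subgroup of rank eps
   + 1 gives eps = q (B - A) with q >= 1. *)
have AB : B = (A + eps)%N.
  have [r0 [i0 [er0 i0M i0_inj i0_ker]]] := height_fiber pres phiM phi_surj phi_a.
  rewrite -/A -/B in er0.
  have le_r0 : (eps.+1 <= r0)%N.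
    apply: vfree_min.
    apply: (height_fiber_finite_index pres phiM phi_surj phi_a nonabelian N0 Zz phi_z)
      i0M i0_inj i0_ker.
  have [q [q0 eq]] := virtually_free_rank pres phiM phi_surj phi_a phi_tau N0 Zz
    phi_z a_z z_gen vfree.
  rewrite -/A -/B in eq.
  by nia.
have psi_rank (psi : G -> infinite_cyclic_group) :
    is_hom psi -> surjective psi -> (psi z : int) != 0%R ->
    exists q r (i : free_group_of_rank r -> G),
    [/\ `|(psi z : int)|%N = (q * N)%N, (0 < q)%N, r = (q * eps + 1)%N,
        is_hom i /\ injective i & forall g, (exists u, i u = g) <-> psi g = 1].
  move=> psiM psi_surj psi_z.
  have trans w : exists g, translation psiM g 0%R = w.
    by have [g gw] := psi_surj w; exists g; rewrite /= gw addr0.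
  have foz := translation_free_orbits psiM psi_surj psi_z.
  have [q [r [i [Iq q0 er iMinj i_stab]]]] := rank _ _ _ _ trans foz.
  exists q, r, i; split=> //; first by rewrite AB in er; nia.
  by move=> g; rewrite i_stab /= addr0; tauto.
split=> [[i [psi [i_inj i_ker psi_surj]]]|[p [p0 ->]]].
  have iM := ghom_is_hom i; have psiM := ghom_is_hom psi.
  have ker g : (exists u, i u = g) <-> psi g = 1.
    split=> [[u iu]|pg]; first by suff : kernel psi g by []; rewrite -i_ker; exists u.
    by have : range i g by [rewrite i_ker]; case=> u _ iu; exists u.
  have psi_z : (psi z : int) != 0%R.
    apply/eqP => pz; have z1 : z = 1 by apply: (fiber_center iM i_inj psiM) ker _ _ _.
    by move: phi_z N0; rewrite z1 is_hom1 // => -[<-].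
  have [q [r [i' [_ q0 er [i'M i'_inj] ker']]]] := psi_rank psi psiM psi_surj psi_z.
  exists q; split=> //; rewrite -er.
  by apply: (same_range_rank iM i'M) => // g; rewrite ker ker'.
(* Otherwise all stable letters are trivial and the vertex generators are commensurable, so b <=
   1. *)
have [e1 e1T] : exists e, e \notin T.
  apply: contrapT => allT; have : (b <= 1)%N.
    apply: (gbs_betti_le1 pres (y := a v0)) x_ind => [v|e].
      have [X [Y [X0 Y0 e1 _]]] := vertex_commensurable pres dT v.
      exists Y, X; split=> //.
      by rewrite -!(is_hom_expgz (to_quotient_hom (derived_subgroup G))) e1.
    exists 1%R, 0%R; split=> //; have [_ relT] := gbs_rel pres.
    rewrite relT ?is_hom1 //; first exact: to_quotient_hom.
    by apply: contrapT => /negP eT; apply: allT; exists e.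
  by rewrite leqNgt b_ge2.
have [|psi [psiM psi_a psi_tau]] := gbs_univ pres (X := infinite_cyclic_group)
    (a' := fun v => ((phi (a v) : int) * Posz p)%R : infinite_cyclic_group)
    (tau' := fun e => if e == e1 then (1%R : int) else 0%R : infinite_cyclic_group).
  split=> [e|e eT]; last by rewrite ifN //; apply: contraNneq e1T => <-.
  rewrite !cyclic_expgzE !cyclic_mulE addrC; congr (_ + _)%R.
  rewrite mulrAC [RHS]mulrAC; congr (_ * _)%R.
  by rewrite mulrC -(height_rel pres phiM phi_tau) mulrC.
have psi_surj : surjective psi.
  move=> k; exists (expgz (tau e1) (k : int)).
  by rewrite is_hom_expgz // psi_tau eqxx cyclic_expgzE mul1r.
(* Evaluating [psi] on a_v0^N = z^h, where h = [phi (a v0)], gives h p N = h [psi z]. *)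
have psi_z : (psi z : int) = (Posz p * Posz N)%R.
  apply: (mulIf (phi_a v0)); have := congr1 psi (a_z v0).
  rewrite !(is_hom_expgz psiM) psi_a !cyclic_expgzE => <-.
  by rewrite -mulrA mulrC.
have psi_z0 : (psi z : int) != 0%R by rewrite psi_z mulf_neq0 // eqz_nat -lt0n.
have [q [r [i [qN q0 er [iM i_inj] ker]]]] := psi_rank psi psiM psi_surj psi_z0.
have qp : q = p.
  by move/eqP: qN; rewrite psi_z abszM /= eqn_pmul2r // => /eqP.
rewrite qp in er; rewrite -er.
exists (ghom_of_hom iM), (ghom_of_hom psiM); split=> //.
by apply/predeqP => g; split=> [[u _ iu]|pg]; [apply/ker; exists u|have /ker[u iu] := pg; exists u].
Qed.
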